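(* Let $\mathfrak M$ be a Nielsen-Schreier variety of $m$-ary algebras over a field $k$, let $A=k_{\mathfrak M}\langle x_1,\ldots,x_n\rangle$ be the free algebra of $\mathfrak M$ freely generated by $x_1,\ldots,x_n$, and let $D$ be an arbitrary element of $\mathscr{L}(A)$. Then the Jacobian matrix $J(D)$ of $D$ is nilpotent if and only if the right multiplication operator $R_D$ is a nilpotent element of the multiplication algebra $M(\mathscr{L}(A))$.
   Context: A variety of algebras $\mathfrak M$ is Nielsen-Schreier if every subalgebra of a free algebra of $\mathfrak M$ is free in $\mathfrak M$. Let $m\ge 2$. An $m$-ary algebra over $k$ is a $k$-vector space with one $m$-ary multilinear operation $\langle\cdot,\ldots,\cdot\rangle$; a derivation is a $k$-linear map satisfying the Leibniz rule for this operation. If $m=2$ and $\mathfrak M$ is a unitary variety (a variety of algebras with identity element), $A$ is assumed to contain an identity element $1$. Convention: varieties are nontrivial and such that free algebras are graded by degrees in the free generators and every map from the free generators to the free algebra extends uniquely to a derivation (automatic if $k$ is infinite). For a column $F=(f_1,\ldots,f_n)'$ of elements of $A$, $D_F=f_1\partial_1+\cdots+f_n\partial_n$ denotes the unique derivation of $A$ with $D_F(x_i)=f_i$ for all $i$; in particular $a\partial_i$ is the derivation with $x_i\mapsto a$ and $x_j\mapsto 0$ for $j\ne i$. Every derivation of $A$ has a unique expression of this form. $\mathscr{L}(A)$ denotes the space $\mathrm{Der}_kA$ of all $k$-linear derivations of $A$ with the bilinear product determined by $(a\partial_i)\cdot(b\partial_j)=((a\partial_i)(b))\partial_j$ for $a,b\in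 A$. $R_D:\mathscr{L}(A)\to\mathscr{L}(A)$ is $u\mapsto u\cdot D$. For an $m$-ary algebra $B$, $b_1,\ldots,b_{m-1}\in B$ and $1\le i\le m$, let $M_i(b_1,\ldots,b_{m-1}):B\to B$ be $x\mapsto\langle b_1,\ldots,b_{i-1},x,b_i,\ldots,b_{m-1}\rangle$. The multiplication algebra $M(B)$ is the associative algebra with identity generated by all these operators (for binary algebras such as $\mathscr{L}(A)$: by all left and right multiplications). Let $C=k_{\mathfrak M}\langle x_1,\ldots,x_n,y_1,\ldots,y_n\rangle$ be the free algebra in $2n$ variables, $\Omega_A\subset C$ the subspace of elements homogeneous of degree $1$ in $y_1,\ldots,y_n$, and $\Omega:C\to C$ the derivation with $x_i\mapsto y_i$, $y_i\mapsto 0$; then $\Omega(A)\subseteq\Omega_A$. For $b_1,\ldots,b_{m-1}\in A$ let $U_i(b_1,\ldots,b_{m-1}):\Omega_A\to\Omega_A$ be the restriction of $M_i(b_1,\ldots,b_{m-1})\in M(C)$. The universal enveloping algebra $A^e$ is the associative algebra with identity generated by all $U_i(b_1,\ldots,b_{m-1})$. $\Omega_A$ is a free left $A^e$-module with basis $y_1,\ldots,y_n$, and for $b\in A$ the Fox derivatives $\frac{\partial b}{\partial x_i}\in A^e$ are defined by $\Omega(b)=\sum_i \frac{\partial b}{\partial x_i}y_i$. The Jacobian matrix of $D=D_F$, $F=(f_1,\ldots,f_n)'$, is the $n\times n$ matrix $J(D)=J(F)=\left(\frac{\partial f_i}{\partial x_j}\right)_{1\le i,j\le n}$ over $A^e$.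 *)

(* Defs.v *)
From HB Require Import structures.
From mathcomp Require Import all_boot all_order all_algebra.
From mathcomp Require Import all_classical.

Set Implicit Arguments.
Unset Strict Implicit.
Unset Printing Implicit Defensive.

Import GRing.Theory.
Local Open Scope classical_set_scope.
Local Open Scope ring_scope.
Local Open Scope quotient_scope.

Definition put (m : nat) (T : Type) (v : 'I_m -> T) (i : 'I_m) (a : T) :
  'I_m -> T := fun j => if j == i then a else v j.

Definition multilinear (k : fieldType) (m : nat) (V : lmodType k)
    (f : ('I_m -> V) -> V) : Prop :=
  forall (v : 'I_m -> V) (i : 'I_m), linear (fun a => f (put v i a)).

(* The flag [u] says whether the algebras are unital.  When [u] is false the
   field [mone] has an empty domain and [mop_one] is vacuous; when [u] is true
   and [m = 2], [mop_one] says [1 b = b] and [b 1 = b]. *)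
Record malg (k : fieldType) (m : nat) (u : bool) := Malg {
  malg_sort :> lmodType k;
  mop : ('I_m -> malg_sort) -> malg_sort;
  mone : u -> malg_sort;
  mop_multilinear : multilinear mop;
  mop_one : forall (h : u) (i : 'I_m) (b : malg_sort),
    mop (put (fun=> mone h) i b) = b
}.
Arguments mop {k m u B} v : rename.
Arguments mone {k m u B} h : rename.

Definition is_hom (k : fieldType) (m : nat) (u : bool) (B B' : malg k m u)
    (f : B -> B') : Prop :=
  [/\ linear f,
      forall v : 'I_m -> B, f (mop v) = mop (f \o v)
    & forall h : u, f (mone h) = mone h].

Definition is_subalgebra (k : fieldType) (m : nat) (u : bool) (B : malg k m u)
    (S : set B) : Prop :=
  [/\ S 0,
      forall (c : k) (a b : B), S a -> S b -> S (c *: a + b),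
      forall v : 'I_m -> B, (forall i, S (v i)) -> S (mop v)
    & forall h : u, S (mone h)].

Definition is_derivation (k : fieldType) (m : nat) (u : bool) (B : malg k m u)
    (d : B -> B) : Prop :=
  linear d /\
  forall v : 'I_m -> B, d (mop v) = \sum_(i < m) mop (put v i (d (v i))).

(* [homog g wt d b]: [b] is a linear combination of monomials of degree [d] in
   the [g x], where [g x] is given the degree [wt x] and the identity element
   the degree [0].  Multilinearity of [mop] makes the closure below equal to
   the span of such monomials. *)
Inductive homog (k : fieldType) (m : nat) (u : bool) (B : malg k m u)
    (X : Type) (g : X -> B) (N : nmodType) (wt : X -> N) : N -> B -> Prop :=
| homog_gen (x : X) : homog g wt (wt x) (g x)
| homog_one (h : u) : homog g wt 0 (mone h)
| homog_zero (d : N) : homog g wt d 0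
| homog_lin (d : N) (c : k) (a b : B) :
    homog g wt d a -> homog g wt d b -> homog g wt d (c *: a + b)
| homog_op (d : 'I_m -> N) (v : 'I_m -> B) :
    (forall i, homog g wt (d i) (v i)) ->
    homog g wt (\sum_(i < m) d i) (mop v).

Inductive term (k : fieldType) (m : nat) (u : bool) (X : Type) : Type :=
| TVar (x : X)
| TOne (h : u)
| TZero
| TAdd (s t : term k m u X)
| TScale (c : k) (t : term k m u X)
| TOp (ts : 'I_m -> term k m u X).
Arguments TVar {k m u X}.
Arguments TOne {k m u X}.
Arguments TZero {k m u X}.

Fixpoint eval (k : fieldType) (m : nat) (u : bool) (B : malg k m u) (X : Type)
    (v : X -> B) (t : term k m u X) : B :=
  match t with
  | TVar x => v x
  | TOne h => mone h
  | TZero => 0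
  | TAdd s t => eval v s + eval v t
  | TScale c t => c *: eval v t
  | TOp ts => mop (fun i => eval v (ts i))
  end.

Fixpoint subst (k : fieldType) (m : nat) (u : bool) (X Y : Type)
    (v : X -> term k m u Y) (t : term k m u X) : term k m u Y :=
  match t with
  | TVar x => v x
  | TOne h => TOne h
  | TZero => TZero
  | TAdd s t => TAdd (subst v s) (subst v t)
  | TScale c t => TScale c (subst v t)
  | TOp ts => TOp (fun i => subst v (ts i))
  end.

Definition models (k : fieldType) (m : nat) (u : bool)
    (E : set (term k m u nat)) (B : malg k m u) : Prop :=
  forall t, E t -> forall v : nat -> B, eval v t = 0.

HB.instance Definition _ k m u X := gen_eqMixin (term k m u X).
HB.instance Definition _ k m u X := gen_choiceMixin (term k m u X).

Section FreeAlgebra.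
Variables (k : fieldType) (m : nat) (u : bool) (E : set (term k m u nat)).
Variable X : Type.
Implicit Types s t : term k m u X.

(* Equality of the elements denoted by [s] and [t] in the free algebra: the
   identity [s = t] holds in the variety. *)
Definition term_eq s t : Prop :=
  forall B : malg k m u, models E B -> forall v : X -> B, eval v s = eval v t.

Definition term_rel : rel (term k m u X) := fun s t => `[< term_eq s t >].

Fact term_rel_refl : reflexive term_rel.
Proof. by move=> t; apply/asboolP. Qed.

Fact term_rel_sym : symmetric term_rel.
Proof.
by move=> s t; apply/asboolP/asboolP => h B hB v; rewrite h.
Qed.

Fact term_rel_trans : transitive term_rel.
Proof.
by move=> t s r /asboolP h1 /asboolP h2; apply/asboolP => B hB v; rewrite h1 ?h2.
Qed.

Canonical term_equiv :=
  EquivRel term_rel term_rel_refl term_rel_sym term_rel_trans.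

Definition free_sort : Type := {eq_quot term_equiv}.
HB.instance Definition _ := Choice.on free_sort.

Definition cls t : free_sort := \pi_{eq_quot term_equiv} t.
Definition rep (a : free_sort) : term k m u X := repr (a : {eq_quot term_equiv}).

Fact repK a : cls (rep a) = a. Proof. exact: reprK. Qed.

Fact clsP s t : cls s = cls t <-> term_eq s t.
Proof.
split; first by move/eqmodP/asboolP.
by move=> h; apply/eqmodP/asboolP.
Qed.

Fact rep_cls t : term_eq (rep (cls t)) t.
Proof. by apply/clsP; rewrite repK. Qed.

Definition fadd (a b : free_sort) := cls (TAdd (rep a) (rep b)).
Definition fscale (c : k) (a : free_sort) := cls (TScale c (rep a)).
Definition fzero := cls TZero.
Definition fopp := fscale (-1).
Definition fop (v : 'I_m -> free_sort) := cls (TOp (fun i => rep (v i))).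

Fact fadd_cls s t : fadd (cls s) (cls t) = cls (TAdd s t).
Proof. by apply/clsP => B hB v /=; rewrite !rep_cls. Qed.

Fact fscale_cls c t : fscale c (cls t) = cls (TScale c t).
Proof. by apply/clsP => B hB v /=; rewrite !rep_cls. Qed.

Fact fop_cls (ts : 'I_m -> term k m u X) : fop (fun i => cls (ts i)) = cls (TOp ts).
Proof.
by apply/clsP => B hB v /=; congr mop; apply/funext => i; rewrite rep_cls.
Qed.

Fact faddA : associative fadd.
Proof.
move=> a b c; rewrite -[a]repK -[b]repK -[c]repK !fadd_cls.
by apply/clsP => B hB v /=; rewrite addrA.
Qed.

Fact faddC : commutative fadd.
Proof.
move=> a b; rewrite -[a]repK -[b]repK !fadd_cls.
by apply/clsP => B hB v /=; rewrite addrC.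
Qed.

Fact fadd0 : left_id fzero fadd.
Proof.
move=> a; rewrite -[a]repK !fadd_cls.
by apply/clsP => B hB v /=; rewrite add0r.
Qed.

Fact faddN : left_inverse fzero fopp fadd.
Proof.
move=> a; rewrite -[a]repK /fopp fscale_cls fadd_cls.
by apply/clsP => B hB v /=; rewrite scaleN1r addNr.
Qed.

HB.instance Definition _ := GRing.isZmodule.Build free_sort faddA faddC fadd0 faddN.

Fact fscaleA a b v : fscale a (fscale b v) = fscale (a * b) v.
Proof.
rewrite -[v]repK !fscale_cls.
by apply/clsP => B hB w /=; rewrite scalerA.
Qed.

Fact fscale1 : left_id 1 fscale.
Proof.
move=> a; rewrite -[a]repK fscale_cls.
by apply/clsP => B hB v /=; rewrite scale1r.
Qed.

Fact fscaleDr : right_distributive fscale +%R.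
Proof.
move=> c a b; rewrite -[a]repK -[b]repK [_ + _]fadd_cls !fscale_cls [RHS]fadd_cls.
by apply/clsP => B hB v /=; rewrite scalerDr.
Qed.

Fact fscaleDl v : {morph fscale^~ v : a b / a + b}.
Proof.
move=> a b; rewrite -[v]repK !fscale_cls [RHS]fadd_cls.
by apply/clsP => B hB w /=; rewrite scalerDl.
Qed.

HB.instance Definition _ := GRing.Zmodule_isLmodule.Build k free_sort
  fscaleA fscale1 fscaleDr fscaleDl.

Fact fop_multilinear : multilinear (fop : ('I_m -> (free_sort : lmodType k)) -> _).
Proof.
move=> v i c a b; rewrite -[a]repK -[b]repK.
rewrite [c *: _]fscale_cls [_ + _]fadd_cls.
have fop_put t : fop (put v i (cls t)) = cls (TOp (put (fun j => rep (v j)) i t)).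
  rewrite -fop_cls; congr fop; apply/funext => j.
  by rewrite /put; case: ifP => // _; rewrite repK.
rewrite !fop_put [c *: _]fscale_cls [RHS]fadd_cls; apply/clsP => B hB w /=.
have eval_put t : (fun j => eval w (put (fun j => rep (v j)) i t j)) =
    put (fun j => eval w (rep (v j))) i (eval w t).
  by apply/funext => j; rewrite /put; case: ifP.
by rewrite !eval_put /= mop_multilinear.
Qed.

Fact fop_one (h : u) (i : 'I_m) (b : free_sort) :
  fop (put (fun=> cls (TOne h)) i b) = b.
Proof.
rewrite -[b]repK.
have -> : put (fun=> cls (TOne h)) i (cls (rep b)) =
    fun j => cls (put (fun=> TOne h) i (rep b) j).
  by apply/funext => j; rewrite /put; case: ifP.
rewrite fop_cls; apply/clsP => B hB w /=.
rewrite -[RHS](mop_one h i); congr mop.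
by apply/funext => j; rewrite /put; case: ifP.
Qed.

Definition free_alg : malg k m u :=
  @Malg k m u free_sort fop (fun h => cls (TOne h)) fop_multilinear fop_one.

Definition gen (x : X) : free_alg := cls (TVar x).

Definition free_lift (B : malg k m u) (f : X -> B) (a : free_alg) : B :=
  eval f (rep a).

End FreeAlgebra.

Section FreeAlgebraTheory.
Variables (k : fieldType) (m : nat) (u : bool) (E : set (term k m u nat)).

Lemma free_lift_cls (X : Type) (B : malg k m u) (f : X -> B) t :
  models E B -> free_lift f (cls E t) = eval f t.
Proof. by move=> hB; rewrite /free_lift (rep_cls t hB). Qed.

Lemma eval_cls (X Y : Type) (v : Y -> term k m u X) (t : term k m u Y) :
  eval (fun y => cls E (v y) : free_alg E X) t =
  cls E (subst v t).
Proof.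
elim: t => //= [s -> t ->|c t ->|ts IH]; [exact: fadd_cls|exact: fscale_cls|].
by rewrite -fop_cls /=; congr fop; apply/funext.
Qed.

Lemma free_alg_models (X : Type) : models E (free_alg E X).
Proof.
move=> t Et v.
have -> : v = (fun y => cls E (rep (v y))) by apply/funext => y; rewrite repK.
rewrite eval_cls; apply/clsP => B hB w /=.
rewrite -[RHS](hB t Et (fun y => eval w (rep (v y)))).
by elim: {Et} t => //= [s -> t ->|c t ->|ts IH] //; congr mop; apply/funext.
Qed.

Lemma free_lift_gen (X : Type) (B : malg k m u) (f : X -> B) x :
  models E B -> free_lift f (gen E x) = f x.
Proof. by move=> hB; rewrite free_lift_cls. Qed.

Lemma free_lift_hom (X : Type) (B : malg k m u) (f : X -> B) :
  models E B -> is_hom (free_lift f : free_alg E X -> B).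
Proof.
move=> hB; split=> [c a b|v|h]; last by rewrite free_lift_cls.
  rewrite -[a]repK -[b]repK [c *: _]fscale_cls [_ + _]fadd_cls.
  by rewrite !free_lift_cls.
have -> : v = (fun i => cls E (rep (v i))) by apply/funext => i; rewrite repK.
rewrite [mop _]fop_cls free_lift_cls //=; congr mop; apply/funext => i /=.
by rewrite free_lift_cls.
Qed.

Lemma eval_gen (X : Type) (a : free_alg E X) : eval (@gen _ _ _ E X) (rep a) = a.
Proof.
rewrite -[RHS]repK eval_cls; congr cls.
by elim: (rep a) => //= [s -> t ->|c t ->|ts IH] //; congr TOp; apply/funext.
Qed.

Lemma hom_eval (X : Type) (B B' : malg k m u) (f : B -> B') (v : X -> B) t :
  is_hom f -> f (eval v t) = eval (f \o v) t.
Proof.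
case=> fl fo f1.
have f0 : f 0 = 0.
  have := fl 1 0 0; rewrite !scale1r addr0 => /(congr1 (fun z => z - f 0)).
  by rewrite subrr addrK => /esym.
elim: t => //= [s <- t <-|c t <-|ts IH].
- by have := fl 1 (eval v s) (eval v t); rewrite !scale1r.
- by have := fl c (eval v t) 0; rewrite f0 !addr0.
- by rewrite fo; congr mop; apply/funext => i /=.
Qed.

Lemma free_lift_uniq (X : Type) (B : malg k m u) (h : free_alg E X -> B) :
  is_hom h -> h = free_lift (h \o @gen _ _ _ E X).
Proof.
by move=> hh; apply/funext => a; rewrite -{1}[a]eval_gen hom_eval.
Qed.

End FreeAlgebraTheory.

(* The sum of the multihomogeneous components is direct; a multidegree is the
   function giving the degree in each generator. *)
Definition graded (k : fieldType) (m : nat) (u : bool) (B : malg k m u)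
    (X : Type) (g : X -> B) : Prop :=
  forall (p : nat) (d : 'I_p -> (X -> nat)) (c : 'I_p -> B),
    injective d ->
    (forall i, homog g (fun x y => `[< x = y >] : nat) (d i) (c i)) ->
    \sum_(i < p) c i = 0 -> forall i, c i = 0.

(* Besides the defining identities, the record carries the standing convention
   that the variety is nontrivial, that its free algebras are graded by the
   degrees in the free generators, and that maps on the free generators extend
   uniquely to derivations; unital algebras are considered only for [m = 2]. *)
Record variety (k : fieldType) (m : nat) (u : bool) := Variety {
  idents :> set (term k m u nat);
  var_unital : u -> m = 2%N;
  var_nontrivial : exists2 B : malg k m u, models idents B & exists b : B, b != 0;
  var_graded : forall X : Type, graded (@gen k m u idents X);
  var_derivation : forall (X : Type) (f : X -> free_alg idents X),
    exists! d : free_alg idents X -> free_alg idents X,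
      is_derivation d /\ forall x, d (gen idents x) = f x
}.

(* The subalgebra [S] is isomorphic to a free algebra of [M]. *)
Definition free_in (k : fieldType) (m : nat) (u : bool)
    (M : variety k m u) (B : malg k m u) (S : set B) : Prop :=
  exists (Y : Type) (h : free_alg M Y -> B),
    [/\ is_hom h, injective h & range h = S].

Definition Nielsen_Schreier (k : fieldType) (m : nat) (u : bool)
    (M : variety k m u) : Prop :=
  forall (X : Type) (S : set (free_alg M X)), is_subalgebra S -> free_in M S.

Inductive in_opalg (k : fieldType) (V : lmodType k) (G : set {linear V -> V}) :
    (V -> V) -> Prop :=
| opalg_id : in_opalg G id
| opalg_gen (f : {linear V -> V}) : G f -> in_opalg G f
| opalg_add (f g : V -> V) :
    in_opalg G f -> in_opalg G g -> in_opalg G (fun x => f x + g x)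
| opalg_scale (c : k) (f : V -> V) : in_opalg G f -> in_opalg G (fun x => c *: f x)
| opalg_comp (f g : V -> V) : in_opalg G f -> in_opalg G g -> in_opalg G (f \o g).

Section OperatorAlgebra.
Variables (k : fieldType) (V : lmodType k) (G : set {linear V -> V}).

Record opalg := Opalg {
  opfun :> V -> V;
  _ : `[< in_opalg G opfun >]
}.
HB.instance Definition _ := [isSub for opfun].
HB.instance Definition _ := [Choice of opalg by <:].

Implicit Types f g h : opalg.

Fact opfunP f : in_opalg G f.
Proof. by case: f => f /= /asboolP. Qed.

Fact opalg_eqP f g : f =1 g -> f = g.
Proof. by move=> fg; apply/val_inj/funext. Qed.

Fact opalg_linear f : linear f.
Proof.
elim: (opfunP f) => //=
  [g _ c a b|g h _ Lg _ Lh c a b|d g _ Lg c a b|g h _ Lg _ Lh c a b].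
- exact: linearP.
- by rewrite Lg Lh scalerDr addrACA.
- by rewrite Lg scalerDr !scalerA mulrC.
- by rewrite /= Lh Lg.
Qed.

Definition mk_op (f : V -> V) (Gf : in_opalg G f) : opalg := Opalg (asboolT Gf).

Definition op_add f g := mk_op (opalg_add (opfunP f) (opfunP g)).
Definition op_scale (c : k) f := mk_op (opalg_scale c (opfunP f)).
Definition op_zero := op_scale 0 (mk_op (opalg_id G)).
Definition op_one := mk_op (opalg_id G).
Definition op_mul f g := mk_op (opalg_comp (opfunP f) (opfunP g)).

Fact op_addA : associative op_add.
Proof. by move=> f g h; apply: opalg_eqP => x /=; rewrite addrA. Qed.
Fact op_addC : commutative op_add.
Proof. by move=> f g; apply: opalg_eqP => x /=; rewrite addrC. Qed.
Fact op_add0 : left_id op_zero op_add.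
Proof. by move=> f; apply: opalg_eqP => x /=; rewrite scale0r add0r. Qed.
Fact op_addN : left_inverse op_zero (op_scale (-1)) op_add.
Proof. by move=> f; apply: opalg_eqP => x /=; rewrite scaleN1r addNr scale0r. Qed.

HB.instance Definition _ :=
  GRing.isZmodule.Build opalg op_addA op_addC op_add0 op_addN.

Fact op_mulA : associative op_mul.
Proof. by move=> f g h; apply: opalg_eqP. Qed.
Fact op_mul1 : left_id op_one op_mul.
Proof. by move=> f; apply: opalg_eqP. Qed.
Fact op_1mul : right_id op_one op_mul.
Proof. by move=> f; apply: opalg_eqP. Qed.
Fact op_mulDl : left_distributive op_mul +%R.
Proof. by move=> f g h; apply: opalg_eqP. Qed.
Fact op_mulDr : right_distributive op_mul +%R.
Proof.
move=> f g h; apply: opalg_eqP => x /=.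
by have := opalg_linear f 1 (g x) (h x); rewrite !scale1r.
Qed.

HB.instance Definition _ :=
  GRing.Zmodule_isPzRing.Build opalg op_mulA op_mul1 op_1mul op_mulDl op_mulDr.

End OperatorAlgebra.

Definition nilpotent_elt (R : pzRingType) (a : R) : Prop :=
  exists s : nat, a ^+ s = 0.

Section MultiplicationAlgebra.
Variables (k : fieldType) (m : nat) (u : bool) (B : malg k m u).

(* [x |-> <b_1, ..., b_(i-1), x, b_i, ..., b_(m-1)>] *)
Definition mult_op (i : 'I_m) (b : 'I_m.-1 -> B) (x : B) : B :=
  mop (fun j => oapp b x (unlift i j)).

Fact mult_opE i b x :
  mult_op i b x = mop (put (fun j => oapp b 0 (unlift i j)) i x).
Proof.
congr mop; apply/funext => j; rewrite /put; case: unliftP => [j' ->|->] /=.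
  by rewrite eq_sym (negbTE (neq_lift _ _)).
by rewrite eqxx.
Qed.

Fact mult_op_linear i b : linear (mult_op i b).
Proof. by move=> c x y; rewrite !mult_opE mop_multilinear. Qed.

HB.instance Definition _ i b :=
  GRing.isLinear.Build k B B *:%R (mult_op i b) (mult_op_linear i b).

Definition mult_gens : set {linear B -> B} :=
  [set f | exists (i : 'I_m) (b : 'I_m.-1 -> B), f = mult_op i b].

Definition mult_alg : Type := opalg mult_gens.
HB.instance Definition _ := GRing.PzRing.on mult_alg.

Fact mult_op_in i b : in_opalg mult_gens (mult_op i b).
Proof. by apply: opalg_gen; exists i, b. Qed.

End MultiplicationAlgebra.

Definition rmult (k : fieldType) (u : bool) (B : malg k 2 u) (b : B) :
  mult_alg B := mk_op (mult_op_in ord0 (fun=> b)).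

Section Derivations.
Variables (k : fieldType) (m : nat) (u : bool) (B : malg k m u).

Definition der_pred : {pred B -> B} := fun d => `[< is_derivation d >].

Fact der_submod_closed : submod_closed der_pred.
Proof.
split=> [|c d e /asboolP[dl dL] /asboolP[el eL]]; apply/asboolP; split.
- by move=> c a b; rewrite /= scaler0 addr0.
- move=> v /=; rewrite big1 // => i _.
  by have := @mop_multilinear _ _ _ B v i (-1) 0 0; rewrite scaler0 addr0 scaleN1r addNr.
- move=> a x y /=; rewrite [LHS]/= !fctE dl el !scalerDr !scalerA [c * a]mulrC.
  by rewrite -!scalerA addrACA -scalerDr.
- move=> v; rewrite !fctE dL eL scaler_sumr -big_split; apply: eq_bigr => i _ /=.
  by rewrite mop_multilinear.
Qed.

HB.instance Definition _ :=
  GRing.isSubmodClosed.Build k (B -> B : lmodType k) der_pred der_submod_closed.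

Record der := Der { der_fun :> B -> B; _ : der_fun \in der_pred }.
HB.instance Definition _ := [isSub for der_fun].
HB.instance Definition _ := [Choice of der by <:].
HB.instance Definition _ := [SubChoice_isSubLmodule of der by <:].

Lemma derP (d : der) : is_derivation d.
Proof. by case: d => d /= /asboolP. Qed.

End Derivations.

Section LeftSymmetric.
Variables (k : fieldType) (m : nat) (u : bool) (M : variety k m u).

Fact der_of_subproof (X : Type) (f : X -> free_alg M X) :
  exists D : der (free_alg M X), forall x, D (gen M x) = f x.
Proof.
have [d [[dD df] _]] := var_derivation f.
by exists (Der (asboolT dD : d \in @der_pred _ _ _ _)).
Qed.

Definition der_of (X : Type) (f : X -> free_alg M X) : der (free_alg M X) :=
  sval (cid (der_of_subproof f)).

Lemma der_of_gen (X : Type) (f : X -> free_alg M X) x : der_of f (gen M x) = f x.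
Proof. exact: (svalP (cid (der_of_subproof f))). Qed.

Lemma der_eq (X : Type) (D E : der (free_alg M X)) :
  (forall x, D (gen M x) = E (gen M x)) -> D = E.
Proof.
move=> DE; have [d [_ dU]] := var_derivation (fun x => E (gen M x)).
apply/val_inj => /=.
by rewrite -(dU D) ?(dU E) //; split=> //; exact: derP.
Qed.

Variable n : nat.
Local Notation A := (free_alg M 'I_n).
Local Notation x := (gen M).

(* The bilinear product with [(a d_i) (b d_j) = ((a d_i) b) d_j], see [LA_mulE]
   and [LA_partialE]. *)
Definition der_mul (D E : der A) : der A := der_of (fun j => D (E (x j))).

Definition der_op (v : 'I_2 -> der A) : der A := der_mul (v ord0) (v ord_max).

Fact der_op_multilinear : multilinear der_op.
Proof.
move=> v i c D E; apply: der_eq => j; rewrite /der_op /der_mul /=.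
rewrite [RHS]/= der_of_gen /= !fctE !der_of_gen /put.
by case: i => [[|[|//]] ?] /=; rewrite ?fctE // (derP _).1.
Qed.

Definition LA : malg k 2 false :=
  @Malg k 2 false (der A) der_op (fun h => False_rect _ (notF h))
    der_op_multilinear (fun h => False_ind _ (notF h)).

Definition partial (a : A) (i : 'I_n) : LA :=
  der_of (fun j => if j == i then a else 0).

Lemma LA_mulE (a b : A) (i j : 'I_n) :
  der_mul (partial a i) (partial b j) = partial ((partial a i : der A) b) j.
Proof.
apply: der_eq => l; rewrite !der_of_gen; case: ifP => // _.
by have := (derP (partial a i)).1 (-1) 0 0; rewrite scaler0 addr0 scaleN1r addNr.
Qed.

Lemma LA_partialE (D : LA) : D = \sum_(i < n) partial ((D : der A) (x i)) i.
Proof.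
apply: der_eq => j.
rewrite (big_morph (fun E : LA => (E : der A) (x j)) (id1 := 0) (op1 := +%R)) //.
rewrite (bigD1 j) //= big1 => [|i ij]; rewrite !der_of_gen ?eqxx ?addr0 //.
by rewrite eq_sym (negbTE ij).
Qed.

Lemma rmultE (D E : LA) : rmult D E = der_mul E D :> LA.
Proof.
rewrite /= /mult_op /=/der_op /=.
case: unliftP => [[]//|_] /=; case: unliftP => //= [][].
Qed.

End LeftSymmetric.

Section Fox.
Variables (k : fieldType) (m : nat) (u : bool) (M : variety k m u) (n : nat).

Local Notation A := (free_alg M 'I_n).
(* [inl i] and [inr i] index the variables [x_i] and [y_i]. *)
Local Notation C := (free_alg M ('I_n + 'I_n)%type).
Local Notation cgen := (@gen k m u M ('I_n + 'I_n)%type).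

Definition ydeg (z : 'I_n + 'I_n) : nat := if z is inr _ then 1 else 0.

Definition Omega_pred : {pred C} := fun c => `[< homog cgen ydeg 1%N c >].

Fact Omega_submod_closed : submod_closed Omega_pred.
Proof.
split=> [|c a b /asboolP ha /asboolP hb]; apply/asboolP; first exact: homog_zero.
exact: homog_lin.
Qed.

HB.instance Definition _ :=
  GRing.isSubmodClosed.Build k C Omega_pred Omega_submod_closed.

Record Omega_mod := Omega { Omega_val :> C; _ : Omega_val \in Omega_pred }.
HB.instance Definition _ := [isSub for Omega_val].
HB.instance Definition _ := [Choice of Omega_mod by <:].
HB.instance Definition _ := [SubChoice_isSubLmodule of Omega_mod by <:].

Fact OmegaP (w : Omega_mod) : homog cgen ydeg 1%N (w : C).
Proof. by case: w => c /= /asboolP. Qed.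

Definition mk_Omega (c : C) (hc : homog cgen ydeg 1%N c) : Omega_mod :=
  Omega (asboolT hc : c \in Omega_pred).

Definition ygen (i : 'I_n) : Omega_mod :=
  mk_Omega (homog_gen cgen ydeg (inr i)).

Definition incl : A -> C := free_lift (fun i : 'I_n => cgen (inl i)).

Fact incl_hom : is_hom incl.
Proof. by apply: free_lift_hom; exact: free_alg_models. Qed.

Fact incl_homog (a : A) : homog cgen ydeg 0%N (incl a).
Proof.
rewrite /incl /free_lift; elim: (rep a) => //=
  [i|h||s hs t ht|c t ht|ts IH].
- exact: (homog_gen cgen ydeg (inl i)).
- exact: (@homog_one _ _ _ _ _ cgen nat ydeg).
- exact: homog_zero.
- by have := homog_lin 1 hs ht; rewrite scale1r.
- by have := homog_lin c ht (homog_zero _ _ _); rewrite addr0.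
- have := homog_op IH; rewrite big1 //.
Qed.

Fact U_subproof (i : 'I_m) (b : 'I_m.-1 -> A) (w : Omega_mod) :
  homog cgen ydeg 1%N (mult_op i (incl \o b) (w : C)).
Proof.
have -> : 1%N = \sum_(j < m) (if j == i then 1%N else 0%N) :> nat.
  by rewrite (bigD1 i) //= eqxx big1 // => j /negbTE ->.
apply: homog_op => j; case: unliftP => [j' ->|->] /=.
  by rewrite eq_sym (negbTE (neq_lift _ _)); exact: incl_homog.
by rewrite eqxx; exact: OmegaP.
Qed.

Definition U (i : 'I_m) (b : 'I_m.-1 -> A) (w : Omega_mod) : Omega_mod :=
  mk_Omega (U_subproof i b w).

Fact U_linear i b : linear (U i b).
Proof. by move=> c v w; apply/val_inj; exact: mult_op_linear. Qed.

HB.instance Definition _ i b :=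
  GRing.isLinear.Build k Omega_mod Omega_mod *:%R (U i b) (U_linear i b).

Definition U_gens : set {linear Omega_mod -> Omega_mod} :=
  [set f | exists (i : 'I_m) (b : 'I_m.-1 -> A), f = U i b].

Definition Ae : Type := opalg U_gens.
HB.instance Definition _ := GRing.PzRing.on Ae.

Definition OmegaD : der C :=
  der_of (fun z => if z is inl i then cgen (inr i) else 0).

(* Fox derivatives: coordinates in the left [Ae]-module [Omega_mod], which has
   basis [ygen] by [Ae_span] and [Ae_free]. *)
Definition is_fox (b : A) (w : 'I_n -> Ae) : Prop :=
  OmegaD (incl b) = \sum_(i < n) (w i (ygen i) : C).

Lemma Ae_span (d : nat) (c : C) : homog cgen ydeg d c ->
  (d = 0%N -> exists a : A, c = incl a) /\
  (d = 1%N -> exists w : 'I_n -> Ae, c = \sum_(i < n) (w i (ygen i) : C)).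
Proof.
have [il io i1] := incl_hom.
have i0 : incl 0 = 0.
  by have := il (-1) 0 0; rewrite scaler0 addr0 scaleN1r addNr.
elim=> {d c}.
- case=> i /=; split=> // _.
    exists (gen M i); rewrite /incl free_lift_gen //; exact: free_alg_models.
  exists (fun j => if j == i then 1 else 0).
  rewrite (bigD1 i) //= eqxx big1 ?addr0 // => j /negbTE ->.
  by rewrite /= scale0r.
- by move=> h; split=> // _; exists (mone h); rewrite i1.
- move=> d; split=> _; first by exists 0.
  by exists (fun=> 0); rewrite big1 // => j _; rewrite /= scale0r.
- move=> d c a b _ [a0 a1] _ [b0 b1]; split=> hd.
    have [[a' ->] [b' ->]] := (a0 hd, b0 hd).
    by exists (c *: a' + b'); rewrite il.
  have [[v ->] [w ->]] := (a1 hd, b1 hd).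
  exists (fun i => op_add (op_scale c (v i)) (w i)).
  by rewrite scaler_sumr -big_split.
- move=> d v _ IH; split=> hd.
    have d0 i : d i = 0%N.
      by apply/eqP; move/eqP: hd; rewrite sum_nat_eq0 => /forallP/(_ i).
    have /choice[a ha] : forall i, exists a, v i = incl a.
      by move=> i; apply: (IH i).1.
    by exists (mop a); rewrite io; congr mop; apply/funext.
  have [i di] : exists i, d i = 1%N.
    apply: contrapT => no1.
    have hi i : d i = 0%N.
      have : (d i <= 1)%N by rewrite -hd; rewrite [X in (_ <= X)%N](bigD1 i) //= leq_addr.
      by case E : (d i) => [|[|]] // _; case: no1; exists i.
    by move: hd; rewrite big1.
  have d0 j : j != i -> d j = 0%N.
    move=> ji; move: hd; rewrite (bigD1 i) //= di.
    by rewrite (bigD1 j) //=; case: (d j).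
  have [w hw] := (IH i).2 di.
  have /choice[a ha] : forall j', exists a, v (lift i j') = incl a.
    by move=> j'; apply: (IH _).1; apply: d0; rewrite eq_sym neq_lift.
  have Uin : in_opalg U_gens (U i a) by apply: opalg_gen; exists i, a.
  exists (fun j => op_mul (mk_op Uin) (w j)).
  transitivity (mult_op i (incl \o a) (v i)).
    congr mop; apply/funext => j; case: unliftP => [j' ->|->] //=.
  by rewrite hw linear_sum.
Qed.

Lemma der_one (h : u) (d : der C) : d (mone h) = 0.
Proof.
have [_ dL] := derP d; have m2 := var_unital M h.
have e1 : mop (fun=> mone h) = mone h :> C.
  have i : 'I_m by rewrite m2; exact: ord0.
  by rewrite -[RHS](mop_one h i); congr mop; apply/funext => j; rewrite /put if_same.
have := dL (fun=> mone h); rewrite e1 (eq_bigr (fun=> d (mone h))) => [|i _].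
  have I2 p (z : C) : p = 2%N -> iter p (+%R z) 0 = z + z by move=> -> /=; rewrite addr0.
  rewrite big_const card_ord I2 // => /(congr1 (fun z => z - d (mone h))).
  by rewrite subrr addrK => /esym.
exact: mop_one.
Qed.

Lemma OmegaD_homog (b : A) : homog cgen ydeg 1%N (OmegaD (incl b)).
Proof.
have [dl dL] := derP OmegaD.
have d0 : OmegaD 0 = 0.
  by have := dl (-1) 0 0; rewrite scaler0 addr0 scaleN1r addNr.
have H t : homog cgen ydeg 0%N (eval (fun i : 'I_n => cgen (inl i)) t).
  have -> : eval (fun i : 'I_n => cgen (inl i)) t = incl (cls M t).
    rewrite /incl free_lift_cls //; exact: free_alg_models.
  exact: incl_homog.
rewrite /incl /free_lift; elim: (rep b) => //= [i|h||s hs t ht|c t ht|ts IH].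
- by rewrite der_of_gen; exact: (homog_gen cgen ydeg (inr i)).
- by rewrite der_one; exact: homog_zero.
- by rewrite d0; exact: homog_zero.
- have := dl 1 (eval (fun i : 'I_n => cgen (inl i)) s)
    (eval (fun i : 'I_n => cgen (inl i)) t).
  by rewrite !scale1r => ->; have := homog_lin 1 hs ht; rewrite scale1r.
- have := dl c (eval (fun i : 'I_n => cgen (inl i)) t) 0.
  rewrite d0 !addr0 => ->.
  by have := homog_lin c ht (homog_zero _ _ _); rewrite addr0.
- rewrite dL; apply: (big_ind (homog cgen ydeg 1%N)) => [|a a' ha ha'|i _].
  + exact: homog_zero.
  + by have := homog_lin 1 ha ha'; rewrite scale1r.
  have -> : 1%N = \sum_(j < m) (if j == i then 1%N else 0%N) :> nat.
    by rewrite (bigD1 i) //= eqxx big1 // => j /negbTE ->.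
  by apply: homog_op => j; rewrite /put; case: ifP => [_|_]; [exact: IH|exact: H].
Qed.

Lemma fox_exists (b : A) : exists w, is_fox b w.
Proof. exact: (Ae_span (OmegaD_homog b)).2. Qed.

Lemma Ae_free (v w : 'I_n -> Ae) :
  \sum_(i < n) (v i (ygen i) : C) = \sum_(i < n) (w i (ygen i) : C) -> v = w.
Proof.
move=> vw; apply/funext => i; apply: opalg_eqP => z.
pose p (s : 'I_n + 'I_n) : C :=
  match s with inl j => cgen (inl j) | inr j => if j == i then z : C else 0 end.
pose phi : C -> C := free_lift p.
have mC : models M C by exact: free_alg_models.
have [pl po p1] : is_hom phi by exact: free_lift_hom.
have p0 : phi 0 = 0.
  by have := pl (-1) 0 0; rewrite scaler0 addr0 scaleN1r addNr.
have pincl a : phi (incl a) = incl a.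
  rewrite /incl /free_lift (hom_eval (f := phi)) //.
  congr eval; apply/funext => j /=.
  by rewrite /phi free_lift_gen.
have ph d c : homog cgen ydeg d c -> homog cgen ydeg d (phi c).
  elim=> {d c} [s|h|d|d c a b _ ha _ hb|d a _ ha].
  - rewrite /phi free_lift_gen //; case: s => j /=.
      exact: (homog_gen cgen ydeg (inl j)).
    by case: ifP => _; [exact: OmegaP|exact: homog_zero].
  - rewrite p1; exact: (@homog_one _ _ _ _ _ cgen nat ydeg).
  - rewrite p0; exact: homog_zero.
  - rewrite pl; exact: homog_lin.
  - rewrite po; exact: homog_op.
pose phiO (c : Omega_mod) : Omega_mod := mk_Omega (ph _ _ (OmegaP c)).
have phiOl : linear phiO by move=> c a b; apply/val_inj; exact: pl.
have comm (f : Ae) c : f (phiO c) = phiO (f c).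
  elim: (opfunP f) c => //= [g [j [b ->]] c|g h _ Hg _ Hh c|d g _ Hg c|g h _ Hg _ Hh c].
  - apply/val_inj; rewrite /= /mult_op po; congr fop; apply/funext => l /=.
    by case: unliftP => //= j' _; rewrite pincl.
  - by rewrite Hg Hh; have := phiOl 1 (g c) (h c); rewrite !scale1r.
  - rewrite Hg; have := phiOl d (g c) 0.
    suff -> : phiO 0 = 0 by rewrite !addr0.
    by apply/val_inj; exact: p0.
  - by rewrite Hh Hg.
have key (f : 'I_n -> Ae) : phi (\sum_(j < n) (f j (ygen j) : C)) = f i z.
  have pA : {morph phi : a b / a + b}.
    by move=> a b; have := pl 1 a b; rewrite !scale1r.
  rewrite (big_morph phi pA p0) (bigD1 i) //= big1 ?addr0 => [|j ji].
    have -> : phi (f i (ygen i)) = phiO (f i (ygen i)) by [].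
    rewrite -comm; congr (Omega_val (f i _)); apply/val_inj => /=.
    by rewrite /phi free_lift_gen //= eqxx.
  have -> : phi (f j (ygen j)) = phiO (f j (ygen j)) by [].
  rewrite -comm.
  have -> : phiO (ygen j) = 0.
    by apply/val_inj; rewrite /= /phi free_lift_gen //= (negbTE ji).
  have := opalg_linear (f j) (-1) 0 0.
  by rewrite scaler0 addr0 scaleN1r addNr => ->.
by apply/val_inj/(etrans (esym (key v))); rewrite vw key.
Qed.

Definition fox (b : A) : 'I_n -> Ae := sval (cid (fox_exists b)).

Lemma foxP (b : A) : is_fox b (fox b).
Proof. exact: (svalP (cid (fox_exists b))). Qed.

Lemma fox_uniq (b : A) (w : 'I_n -> Ae) : is_fox b w -> w = fox b.
Proof. by move=> hw; apply: Ae_free; rewrite -hw; exact: foxP. Qed.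

Definition jacobian (D : LA M n) : 'M[Ae]_n :=
  \matrix_(i, j) fox ((D : der A) (gen M i)) j.

End Fox.

(* Main.v *)
(** Writing [D = D_F] and [E = D_G], one has [R_D^s(E) = D_(J(D)^s G)], where [A^e] acts
    on [A].  So [J(D)^s = 0] gives [R_D^s = 0], and conversely [R_D^s = 0] says that the
    entries of [J(D)^s] annihilate [A]; it remains to see that they vanish.

    If all products of generators vanish, then [A] is spanned by the [x_i] and these
    entries are scalars.  Otherwise let [z] be a nonzero product of generators involving
    [x_i].  In a free subalgebra, elements that are linearly independent modulo
    decomposables are free generators of the subalgebra that they generate.  Applied to
    the subalgebra of the elements without linear term in [x_i], this shows that [z] and
    the [x_j], [j <> i], are free; if a further homogeneous element [b] is free together
    with them, then [A^e] acts faithfully on [A].  If there is no such [b] for any [i],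
    then all elements without linear term in [x_i] are polynomials in [z] and the [x_j],
    [j <> i]; comparing multidegrees, this is contradictory when [z] involves two
    generators, and when [z = <x_i, .., x_i>] the endomorphism [x_i |-> x_i + z] gives
    [<z, .., z> = 0], against the freeness of [z]. *)
Require Import Defs.
From HB Require Import structures.
From mathcomp Require Import all_boot all_order all_algebra.
From mathcomp Require Import all_classical.
From mathcomp Require Import zify.

Set Implicit Arguments.
Unset Strict Implicit.
Unset Printing Implicit Defensive.

Import GRing.Theory.
Local Open Scope classical_set_scope.
Local Open Scope ring_scope.

(** * Linear maps and multilinear operations *)

Section LinearMaps.
Variables (k : fieldType) (U V : lmodType k) (f : U -> V) (fl : linear f).

Let g : {linear U -> V} := HB.pack f (GRing.isLinear.Build k U V *:%R f fl).

Lemma lin0 : f 0 = 0. Proof. exact: (linear0 g). Qed.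
Lemma linD : {morph f : a b / a + b}. Proof. exact: (linearD g). Qed.
Lemma linB : {morph f : a b / a - b}. Proof. exact: (linearB g). Qed.
Lemma linZ c a : f (c *: a) = c *: f a. Proof. exact: (linearZZ g). Qed.
Lemma lin_sum I r (P : pred I) (F : I -> U) :
  f (\sum_(i <- r | P i) F i) = \sum_(i <- r | P i) f (F i).
Proof. exact: (linear_sum g). Qed.
End LinearMaps.

Section Operation.
Variables (k : fieldType) (m : nat) (u : bool) (B : malg k m u).
Implicit Types (v : 'I_m -> B) (i : 'I_m).

Lemma put_id v i : put v i (v i) = v.
Proof. by apply/funext => j; rewrite /put; case: eqP => // ->. Qed.

Lemma put_eq v i a : put v i a i = a.
Proof. by rewrite /put eqxx. Qed.

Lemma put_neq v i a j : j != i -> put v i a j = v j.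
Proof. by rewrite /put => /negbTE ->. Qed.

Lemma mop0 v i : v i = 0 -> mop v = 0.
Proof. by move=> v0; rewrite -(put_id v i) v0 (lin0 (mop_multilinear v i)). Qed.

(* Telescopes over the slots. *)
Lemma mop_congr (S : set B) (v v' : 'I_m -> B) :
  S 0 -> (forall a b, S a -> S b -> S (a + b)) ->
  (forall (w : 'I_m -> B) i, (forall j, w j = v j \/ w j = v' j) ->
     S (mop (put w i (v i - v' i)))) ->
  S (mop v - mop v').
Proof.
move=> S0 SD Sm.
pose w l := fun j : 'I_m => if (j < l)%N then v' j else v j.
have w0 : w 0%N = v by apply/funext.
have wm : w m = v' by apply/funext => j; rewrite /w ltn_ord.
have H l : (l <= m)%N -> S (mop v - mop (w l)).
  elim: l => [|l IH] lm; first by rewrite w0 subrr.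
  rewrite -(subrK (mop (w l)) (mop v)) -addrA; apply: SD; first exact/IH/ltnW.
  pose i := Ordinal lm.
  have -> : w l.+1 = put (w l) i (v' i).
    apply/funext => j; rewrite /w /put ltnS leq_eqVlt -val_eqE /=.
    case: (nat_of_ord j =P l) => [jl|//] /=.
    by congr v'; apply/val_inj.
  have -> : mop (w l) = mop (put (w l) i (v i)).
    congr mop; apply/funext => j; rewrite /put; case: eqP => // ->.
    by rewrite /w /= ltnn.
  rewrite -(linB (mop_multilinear _ i)); apply: Sm => j.
  by rewrite /w; case: ifP; [right|left].
by rewrite -wm; exact: H.
Qed.

(** The slots pass from [T] to [R] one at a time while the others stay fixed, so only linear maps in
    one slot matter. The intended case is [R i] spanned by [T i]. *)
Lemma mop_span (S : set B) (T R : 'I_m -> set B) :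
  (forall v, (forall i, T i (v i)) -> S (mop v)) ->
  (forall i (L : B -> B), linear L -> (forall a, T i a -> S (L a)) ->
    forall a, R i a -> S (L a)) ->
  forall v, (forall i, R i (v i)) -> S (mop v).
Proof.
move=> Sm RT v Rv.
suff H l : (l <= m)%N -> forall w, (forall i : 'I_m, (i < l)%N -> R i (w i)) ->
    (forall i : 'I_m, (l <= i)%N -> T i (w i)) -> S (mop w).
  by apply: (H m) => // i; rewrite leqNgt ltn_ord.
elim: l => [|l IH] lm w Rw Tw; first by apply: Sm => i; exact: Tw.
pose i := Ordinal lm; rewrite -(put_id w i).
apply: (RT i (fun a => mop (put w i a)) (mop_multilinear w i)); last exact: Rw.
move=> a Ta; apply: IH => [|j jl|j lj]; first exact: ltnW.
  rewrite put_neq; first by apply: Rw; rewrite ltnS ltnW.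
  by apply: contraTneq jl => ->; rewrite ltnn.
have [->|ji] := eqVneq j i; first by rewrite put_eq.
rewrite put_neq //; apply: Tw; rewrite ltn_neqAle lj andbT.
by apply: contra_neq ji => ij; apply/val_inj.
Qed.
End Operation.

(** * Multidegrees *)

Section Degrees.
Variable X : Type.

Definition mdeg (x : X) : X -> nat := fun y => `[< x = y >].

Lemma mdeg1 x : mdeg x x = 1%N.
Proof. by rewrite /mdeg; case: asboolP. Qed.

Lemma mdeg_neq x y : x <> y -> mdeg x y = 0%N.
Proof. by rewrite /mdeg; case: asboolP. Qed.
End Degrees.

Section WeightedDegree.
Variable X : finType.

Definition wdeg (w : X -> nat) (d : X -> nat) : nat := (\sum_x w x * d x)%N.
Definition tdeg : (X -> nat) -> nat := wdeg (fun=> 1%N).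

Lemma wdeg_mdeg w x : wdeg w (mdeg x) = w x.
Proof.
rewrite /wdeg (bigD1 x) //= mdeg1 muln1 big1 ?addn0 // => y /eqP yx.
by rewrite mdeg_neq ?muln0 // => /esym.
Qed.

Lemma wdeg0 w : wdeg w 0 = 0%N.
Proof. by rewrite /wdeg big1 // => x _; rewrite muln0. Qed.

Lemma wdeg_sum w I (r : seq I) (P : pred I) (d : I -> (X -> nat)) :
  wdeg w (\sum_(i <- r | P i) d i) = (\sum_(i <- r | P i) wdeg w (d i))%N.
Proof.
rewrite /wdeg exchange_big /=; apply: eq_bigr => x _.
by rewrite fct_sumE big_distrr.
Qed.

Lemma tdeg_eq0 (d : X -> nat) : tdeg d = 0%N -> d = 0.
Proof.
move/eqP; rewrite /tdeg /wdeg sum_nat_eq0 => /forallP h.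
by apply/funext => x; have := h x; rewrite mul1n => /eqP.
Qed.

Lemma tdeg_gt0 (d : X -> nat) : d <> 0 -> (0 < tdeg d)%N.
Proof. by move=> d0; rewrite lt0n; apply/eqP => /tdeg_eq0. Qed.
End WeightedDegree.

(** * Spans of multihomogeneous elements *)

Section Grading.
Variables (k : fieldType) (m : nat) (u : bool) (M : variety k m u).

Lemma models_free X : models M (free_alg M X).
Proof. exact: free_alg_models. Qed.

Lemma lift_gen X Y (f : X -> free_alg M Y) x : free_lift f (gen M x) = f x.
Proof. exact/free_lift_gen/models_free. Qed.

Lemma lift_hom X Y (f : X -> free_alg M Y) :
  is_hom (free_lift f : free_alg M X -> free_alg M Y).
Proof. exact/free_lift_hom/models_free. Qed.

Lemma hom_lift X (B B' : malg k m u) (g : B -> B') (f : X -> B) (a : free_alg M X) :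
  is_hom g -> g (free_lift f a) = free_lift (g \o f) a.
Proof. exact: hom_eval. Qed.

Lemma lift_id X (a : free_alg M X) : free_lift (gen M (X := X)) a = a.
Proof. exact: eval_gen. Qed.

Lemma hom_gen X Y (f : free_alg M X -> free_alg M Y) a :
  is_hom f -> f a = free_lift (fun x => f (gen M x)) a.
Proof. by move=> hf; rewrite [in LHS](free_lift_uniq hf). Qed.

Lemma gen_neq0 X (x : X) : gen M x != 0.
Proof.
apply/eqP => x0; have [B hB [b /eqP b0]] := var_nontrivial M; apply: b0.
rewrite -(free_lift_gen (fun=> b) x hB) x0.
by have [l _ _] := free_lift_hom (fun _ : X => b) hB; rewrite (lin0 l).
Qed.

Definition mhomog X : (X -> nat) -> free_alg M X -> Prop :=
  homog (gen M (X := X)) (@mdeg X).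

Section Span.
Variable X : Type.
Local Notation A := (free_alg M X).
Implicit Types (P Q : set (X -> nat)) (a b : A).

(** No scalars occur in [hspan_cons], since each [mhomog d] is closed under scaling. A set of
    multidegrees lets one notion express homogeneity, degree bounds and divisibility conditions. *)
Inductive hspan P : A -> Prop :=
| hspan0 : hspan P 0
| hspan_cons d a b : P d -> mhomog d a -> hspan P b -> hspan P (a + b).

Lemma hspan_homog P d a : P d -> mhomog d a -> hspan P a.
Proof. by move=> Pd ha; rewrite -(addr0 a); exact: (hspan_cons Pd ha (hspan0 P)). Qed.

Lemma hspanD P a b : hspan P a -> hspan P b -> hspan P (a + b).
Proof.
move=> + hb; elim=> [|d a' b' Pd ha _ IH]; first by rewrite add0r.
by rewrite -addrA; exact: (hspan_cons Pd ha IH).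
Qed.

Lemma mhomogZ d c a : mhomog d a -> mhomog d (c *: a).
Proof. by move=> ha; rewrite -[c *: a]addr0; apply: homog_lin => //; exact: homog_zero. Qed.

Lemma hspanZ P c a : hspan P a -> hspan P (c *: a).
Proof.
elim=> [|d a' b' Pd ha _ IH]; first by rewrite scaler0; exact: hspan0.
by rewrite scalerDr; exact: (hspan_cons Pd (mhomogZ c ha) IH).
Qed.

Lemma hspanN P a : hspan P a -> hspan P (- a).
Proof. by rewrite -scaleN1r; exact: hspanZ. Qed.

Lemma hspanB P a b : hspan P a -> hspan P b -> hspan P (a - b).
Proof. by move=> ha hb; apply: hspanD => //; exact: hspanN. Qed.

Lemma hspan_sum P I (r : seq I) (R : pred I) (F : I -> A) :
  (forall i, R i -> hspan P (F i)) -> hspan P (\sum_(i <- r | R i) F i).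
Proof. by move=> h; elim/big_ind: _ => //; [exact: hspan0|exact: hspanD]. Qed.

Lemma hspan_sub P Q a : P `<=` Q -> hspan P a -> hspan Q a.
Proof.
move=> PQ; elim=> [|d a' b' Pd ha _ IH]; first exact: hspan0.
exact: (hspan_cons (PQ _ Pd) ha IH).
Qed.

Lemma hspan_split P Q a : hspan (P `|` Q) a ->
  exists b c, [/\ hspan P b, hspan Q c & a = b + c].
Proof.
elim=> [|d a' b' [Pd|Qd] ha _ [b [c [hb hc ->]]]].
- by exists 0, 0; split; rewrite ?addr0 //; exact: hspan0.
- exists (a' + b), c; split; rewrite ?addrA //; exact: (hspan_cons Pd ha hb).
- exists b, (a' + c); split; rewrite ?[a' + (b + c)]addrCA //; exact: (hspan_cons Qd ha hc).
Qed.

Lemma hspan_lin P (B : lmodType k) (L : A -> B) (S : set B) : linear L -> S 0 ->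
  (forall x y, S x -> S y -> S (x + y)) ->
  (forall d a, P d -> mhomog d a -> S (L a)) ->
  forall a, hspan P a -> S (L a).
Proof.
move=> Ll S0 SD H a; elim=> [|d a' b' Pd ha _ IH]; first by rewrite (lin0 Ll).
by rewrite (linD Ll); apply: SD IH; exact: (H d).
Qed.

(** By multilinearity the slots may be taken homogeneous, and then degrees add. *)
Lemma hspan_mop (P : 'I_m -> set (X -> nat)) (Q : set (X -> nat)) (v : 'I_m -> A) :
  (forall d : 'I_m -> (X -> nat), (forall i, P i (d i)) -> Q (\sum_i d i)) ->
  (forall i, hspan (P i) (v i)) -> hspan Q (mop v).
Proof.
move=> PQ; apply: (@mop_span _ _ _ _ (hspan Q)
    (fun i a => exists2 d, P i d & mhomog d a) (fun i => hspan (P i))).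
  move=> w Tw; pose d i := projT1 (cid2 (Tw i)).
  have [Pd hd] : (forall i, P i (d i)) /\ (forall i, mhomog (d i) (w i)).
    by split=> i; rewrite /d; case: cid2.
  by apply: (hspan_homog (PQ d Pd)); exact: homog_op.
move=> i L Ll H; apply: (hspan_lin Ll); [exact: hspan0|exact: hspanD|].
by move=> d a Pd ha; apply: H; exists d.
Qed.

Lemma hspan_all a : hspan setT a.
Proof.
rewrite -(lift_id a) /free_lift; elim: (rep a) => /= [x|h||s hs t ht|c t ht|ts IH].
- exact: (hspan_homog (d := mdeg x)) (homog_gen _ _ x).
- exact: (hspan_homog (d := 0)) (homog_one _ _ h).
- exact: hspan0.
- exact: hspanD.
- exact: hspanZ.
- exact: (@hspan_mop (fun=> setT)).
Qed.

Lemma hspan_case P a : exists b c, [/\ hspan P b, hspan (~` P) c & a = b + c].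
Proof. by apply: hspan_split; rewrite setUv; exact: hspan_all. Qed.

(** Summands of equal degree are collected, so that the degrees become distinct, as [var_graded]
    requires. *)
Lemma hspan_list P a : hspan P a -> exists (s : seq (X -> nat)) (c : (X -> nat) -> A),
  [/\ uniq s, forall d, d \in s -> P d, forall d, d \in s -> mhomog d (c d)
    & a = \sum_(d <- s) c d].
Proof.
elim=> [|d a' b' Pd ha _ [s [c [us Ps hs ->]]]].
  by exists [::], (fun=> 0); split=> //; rewrite big_nil.
have [ds|ds] := boolP (d \in s).
  exists s, (fun e => if e == d then a' + c d else c e); split=> // [e es|].
    case: eqP => [->|_]; last exact: hs.
    by rewrite -[a']scale1r; apply: homog_lin => //; exact: hs.
  rewrite !(bigD1_seq d ds us) /= eqxx addrA; congr +%R.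
  by apply: eq_bigr => e /negbTE ->.
exists (d :: s), (fun e => if e == d then a' else c e); split.
- by rewrite /= ds.
- by move=> e; rewrite inE => /orP[/eqP ->|/Ps].
- by move=> e; rewrite inE; case: eqP => [->|_] // /hs.
rewrite big_cons eqxx; congr +%R; rewrite !big_seq; apply: eq_bigr => e es.
by case: eqP => // ed; rewrite ed (negbTE ds) in es.
Qed.

(** The grading axiom enters here: the difference of two expansions of [a] is a vanishing sum of
    components of distinct degrees, which are therefore all zero. *)
Lemma hspan_disj P Q a : (forall d, P d -> Q d -> False) ->
  hspan P a -> hspan Q a -> a = 0.
Proof.
move=> PQ /hspan_list[s [c [us Ps hs ac]]] /hspan_list[t [e [ut Qt ht ae]]].
pose f d := if d \in s then c d else - e d.
have st : uniq (s ++ t).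
  rewrite cat_uniq us ut andbT /=; apply/hasPn => d dt; apply/negP => ds.
  exact: (PQ d (Ps _ ds) (Qt _ dt)).
have tf d : d \in t -> f d = - e d.
  by rewrite /f; case: ifP => // ds dt; case: (PQ d); [exact: Ps|exact: Qt].
have sum0 : \sum_(d <- s ++ t) f d = 0.
  rewrite big_cat /= [X in X + _](_ : _ = a) ?[X in _ + X](_ : _ = - a) ?subrr //.
    by rewrite ae raddf_sum !big_seq; apply: eq_bigr => d /tf.
  by rewrite ac !big_seq; apply: eq_bigr => d ds; rewrite /f ds.
pose dd (i : 'I_(size (s ++ t))) := nth (0 : X -> nat) (s ++ t) i.
have ff : forall i, f (dd i) = 0.
  apply: (@var_graded _ _ _ M X _ dd (f \o dd)).
  - by move=> i j /eqP; rewrite nth_uniq // => /eqP ij; apply/val_inj.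
  - move=> i; rewrite /= /f; case: ifP => [/hs//|ds].
    rewrite -scaleN1r; apply/mhomogZ/ht.
    by have := mem_nth 0 (ltn_ord i); rewrite mem_cat -/(dd i) ds.
  - by rewrite -[RHS]sum0 (big_nth 0) big_mkord.
rewrite ac big_seq big1 // => d ds.
have di : (index d (s ++ t) < size (s ++ t))%N by rewrite index_mem mem_cat ds.
have := ff (Ordinal di); rewrite /dd /= nth_index ?mem_cat ?ds //.
by rewrite /f ds.
Qed.

Lemma mhomog_neq P d a : mhomog d a -> hspan P a -> ~ P d -> a = 0.
Proof.
move=> ha hP nP.
have hs : hspan [set d] a by exact: (hspan_homog (erefl d) ha).
by apply: hspan_disj hP hs => e Pe ed; apply: nP; rewrite -ed.
Qed.
End Span.
End Grading.

(** * Homomorphisms and degrees *)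

Section GradedHoms.
Variables (k : fieldType) (m : nat) (u : bool) (M : variety k m u).
Variables (X Y : finType).

Lemma lift_graded (w : X -> nat) (p : X -> free_alg M Y) :
  (forall x, hspan [set e | tdeg e = w x] (p x)) ->
  forall d (c : free_alg M X), mhomog d c ->
  hspan [set e | tdeg e = wdeg w d] (free_lift p c).
Proof.
move=> hp d c; have [fl fo f1] := lift_hom p.
elim=> {d c} [x|h|d|d c a b _ IHa _ IHb|d v _ IH].
- by rewrite lift_gen wdeg_mdeg.
- rewrite f1; apply: (hspan_homog (d := 0)) (homog_one _ _ h).
  by rewrite /= /tdeg !wdeg0.
- by rewrite (lin0 fl); exact: hspan0.
- by rewrite fl; apply: hspanD IHb; exact: hspanZ.
- rewrite fo; apply: hspan_mop IH => e he /=.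
  by rewrite /tdeg !wdeg_sum; apply: eq_bigr => i _; exact: he.
Qed.

Section Perturbation.
Variable R : nat -> nat -> Prop.
Hypothesis RD : forall a b c d, R a b -> c = d \/ R c d -> R (a + c)%N (b + d)%N.

Lemma rel_sum (I : finType) (a b : I -> nat) i : R (a i) (b i) ->
  (forall j, a j = b j \/ R (a j) (b j)) -> R (\sum_j a j)%N (\sum_j b j)%N.
Proof.
move=> Ri Rj; rewrite (bigD1 i) //= [X in R _ X](bigD1 i) //=; apply: RD => //.
elim/big_ind2: _ => //; first by left.
move=> x1 x2 y1 y2 [-> [->|h]|h h']; [by left| |right; exact: RD].
by right; rewrite addnC [X in R _ X]addnC; apply: RD h _; left.
Qed.

(** [R] stands for [<] or [>]. In the telescoped difference of two products one slot carries a
    strict change of degree and the others at worst a change in the same direction, so the total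
    change is strict. *)
Lemma lift_perturb (w : X -> nat) (p q : X -> free_alg M Y) :
  (forall x, hspan [set e | tdeg e = w x] (p x)) ->
  (forall x, hspan [set e | R (tdeg e) (w x)] (q x - p x)) ->
  forall d (c : free_alg M X), mhomog d c ->
  hspan [set e | R (tdeg e) (wdeg w d)] (free_lift q c - free_lift p c).
Proof.
move=> hp hq d c hc; have [pl po p1] := lift_hom p; have [ql qo q1] := lift_hom q.
have hP e (b : free_alg M X) := @lift_graded w p hp e b.
elim: hc => {d c} [x|h|d|d c a b _ IHa _ IHb|d v hv IH].
- by rewrite !lift_gen wdeg_mdeg.
- by rewrite p1 q1 subrr; exact: hspan0.
- by rewrite (lin0 pl) (lin0 ql) subrr; exact: hspan0.
- rewrite pl ql opprD addrACA -scalerBr; apply: hspanD IHb; exact: hspanZ.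
- rewrite po qo; apply: mop_congr; [exact: hspan0|exact: hspanD|] => s i hs.
  pose S j : set (Y -> nat) := [set e | tdeg e = wdeg w (d j) \/ R (tdeg e) (wdeg w (d j))].
  have hpj j : hspan (S j) (free_lift p (v j)).
    by apply: hspan_sub (hP _ _ (hv j)) => e; left.
  apply: (@hspan_mop _ _ _ _ _ (fun j => if j == i then
     [set e | R (tdeg e) (wdeg w (d j))] else S j)) => [e he|j].
    rewrite /= /tdeg !wdeg_sum; apply: (@rel_sum _ _ _ i).
      by have := he i; rewrite eqxx.
    by move=> j; have := he j; case: ifP => _ //=; right.
  case: eqP => [->|/eqP ji]; first by rewrite put_eq; exact: IH.
  rewrite put_neq //; case: (hs j) => ->; last exact: hpj.
  rewrite /= -(subrK (free_lift p (v j)) (free_lift q (v j))).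
  by apply: hspanD (hpj j); apply: hspan_sub (IH j) => e; right.
Qed.
End Perturbation.
End GradedHoms.

Section Separated.
Variables (k : fieldType) (m : nat) (u : bool) (M : variety k m u) (X : finType).

Lemma hspan_bounded (w : X -> nat) (a : free_alg M X) :
  exists N, hspan [set e | wdeg w e < N]%N a.
Proof.
have [s [c [_ _ hc ->]]] := hspan_list (hspan_all a).
exists (\max_(d <- s) wdeg w d).+1; rewrite [X in hspan _ X]big_seq.
apply: hspan_sum => d ds; apply: (hspan_homog _ (hc d ds)).
by rewrite /= ltnS; apply: leq_bigmax_seq.
Qed.

(** The degree filtration is separated because an element involves only finitely many degrees. *)
Lemma hspan_ge0 (a : free_alg M X) :
  (forall N, hspan [set e | N <= tdeg e]%N a) -> a = 0.
Proof.
move=> h; have [N hN] := hspan_bounded (fun=> 1%N) a.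
by apply: hspan_disj (h N) hN => d /=; rewrite leqNgt => /negbTE ->.
Qed.
End Separated.

(** * Endomorphisms equal to the identity up to higher degree *)

Section Unipotent.
Variables (k : fieldType) (m : nat) (u : bool) (M : variety k m u) (X : finType).
Variable q : X -> free_alg M X.
Hypothesis hq : forall x, hspan [set e | 1 < tdeg e]%N (q x - gen M x).

Lemma gen_tdeg1 (x : X) : hspan [set e | tdeg e = 1%N] (gen M x).
Proof. by apply: (hspan_homog _ (homog_gen _ _ x)); rewrite /= /tdeg wdeg_mdeg. Qed.

Lemma unip_raise N a : hspan [set e | N <= tdeg e]%N a ->
  hspan [set e | N < tdeg e]%N (free_lift q a - a).
Proof.
have [ql _ _] := lift_hom q.
apply: (hspan_lin (L := fun a => free_lift q a - a)).
- by move=> c x y; rewrite ql opprD addrACA -scalerBr.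
- exact: hspan0.
- exact: hspanD.
move=> d c /= Nd hc; rewrite -[X in _ - X]lift_id.
apply: hspan_sub (@lift_perturb _ _ _ _ _ _ (fun x y => y < x)%N _ (fun=> 1%N) _ _ _ _ _ _ hc).
- by move=> e /= /(leq_ltn_trans Nd).
- by move=> x y z t; lia.
- exact: gen_tdeg1.
- exact: hq.
Qed.

(** If [a] is killed, then [unip_raise] moves it into ever higher degrees, and the filtration is
    separated. *)
Lemma unip_inj : injective (free_lift q : free_alg M X -> free_alg M X).
Proof.
have [ql _ _] := lift_hom q.
suff H (a : free_alg M X) : free_lift q a = 0 -> a = 0.
  by move=> a b ab; apply/subr0_eq/H; rewrite (linB ql) ab subrr.
move=> qa; apply: hspan_ge0.
elim=> [|N /unip_raise]; first exact: hspan_sub (hspan_all a).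
by rewrite qa sub0r => /hspanN; rewrite opprK.
Qed.

(** Successive approximation: adding the remainder [r] to [b] leaves the remainder
    [r - free_lift q r], of higher degree. *)
Lemma unip_dense N a : exists b : free_alg M X, hspan [set e | N <= tdeg e]%N (a - free_lift q b).
Proof.
have [ql _ _] := lift_hom q.
elim: N => [|N [b /[dup] hb /unip_raise /hspanN]].
  by exists 0; exact: hspan_sub (hspan_all _).
set r := a - free_lift q b => h; exists (b + r).
by rewrite (linD ql) opprD addrA -/r -opprB.
Qed.

End Unipotent.


(** * Constants and decomposable elements *)

Section Constants.
Variables (k : fieldType) (m : nat) (u : bool) (B : malg k m u).

Definition is_const (a : B) : Prop := a = 0 \/ exists (h : u) (c : k), a = c *: mone h.

(** A nonzero constant exists only in the unital binary case, where multiplying by it scales the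
    other factor; that factor also carries the whole degree. *)
Lemma mop_const (v : 'I_m -> B) (i : 'I_m) : (u -> m = 2%N) -> is_const (v i) ->
  mop v = 0 \/ exists (c : k) (j : 'I_m), mop v = c *: v j /\
    forall (N : nmodType) (d : 'I_m -> N), d i = 0 -> \sum_l d l = d j.
Proof.
move=> m2 [v0|[h [c vi]]]; first by left; exact: (mop0 v0).
right; have {}m2 := m2 h.
have [j ji I2] : exists2 j : 'I_m, j != i & forall l, l = i \/ l = j.
  (* As [m = 2], the other slot has index [1 - i]. *)
  case: i vi => i im vi; have jm : (1 - i < m)%N by lia.
  exists (Ordinal jm) => [|[l lm]]; first by rewrite -val_eqE /=; lia.
  case: (l =P i) => li; [left|right]; apply/val_inj => //=; lia.
exists c, j; split=> [|N d di].
  transitivity (mop (put (put (fun=> mone h) j (v j)) i (c *: mone h))).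
    congr mop; apply/funext => l; rewrite /put; case: eqP => [->|li] //; case: eqP => [->|lj] //.
    by case: (I2 l).
  rewrite (linZ (mop_multilinear _ _)); congr (c *: _).
  rewrite -[RHS](mop_one h j) /put; congr mop; apply/funext => l.
  by case: (l =P i) => // ->; rewrite eq_sym (negbTE ji).
rewrite (bigD1 i) //= di add0r (bigD1 j) //= big1 ?addr0 // => l /andP[/eqP li /eqP lj].
by case: (I2 l).
Qed.

Lemma is_constZ c a : is_const a -> is_const (c *: a).
Proof.
move=> [->|[h [e ->]]]; first by left; rewrite scaler0.
by right; exists h, (c * e); rewrite scalerA.
Qed.

Lemma is_constD a b : is_const a -> is_const b -> is_const (a + b).
Proof.
move=> [->|[h [e ->]]]; first by rewrite add0r.
move=> [->|[h' [e' ->]]]; first by rewrite addr0; right; exists h, e.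
by right; exists h, (e + e'); rewrite scalerDl (bool_irrelevance h' h).
Qed.
End Constants.

Lemma is_const_hom (k : fieldType) (m : nat) (u : bool) (B B' : malg k m u)
    (f : B -> B') a : is_hom f -> is_const a -> is_const (f a).
Proof.
move=> [fl _ f1] [->|[h [c ->]]]; first by left; rewrite (lin0 fl).
by right; exists h, c; rewrite (linZ fl) f1.
Qed.

Section Decomposables.
Variables (k : fieldType) (m : nat) (u : bool).

(** [S] will be the part without constant term of a subalgebra: with the identity in [S], the law
    [1 b = b] would make every element decomposable. *)
Inductive decomp (B : malg k m u) (S : set B) : B -> Prop :=
| decomp0 : decomp S 0
| decomp_lin c a b : decomp S a -> decomp S b -> decomp S (c *: a + b)
| decomp_mop v : (forall i, S (v i)) -> decomp S (mop v).

Lemma decomp_hom (B B' : malg k m u) (f : B -> B') (S : set B) (S' : set B') a :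
  is_hom f -> (forall x, S x -> S' (f x)) -> decomp S a -> decomp S' (f a).
Proof.
move=> [fl fo _] SS'; elim=> [|c x y _ hx _ hy|v Sv].
- by rewrite (lin0 fl); exact: decomp0.
- by rewrite fl; exact: decomp_lin.
- by rewrite fo; apply: decomp_mop => i; exact/SS'/Sv.
Qed.

Lemma decompZ (B : malg k m u) (S : set B) c a : decomp S a -> decomp S (c *: a).
Proof. by move=> h; rewrite -[c *: a]addr0; apply: decomp_lin h _; exact: decomp0. Qed.

Lemma decompD (B : malg k m u) (S : set B) a b :
  decomp S a -> decomp S b -> decomp S (a + b).
Proof. by move=> ha hb; rewrite -[a]scale1r; exact: decomp_lin. Qed.

Lemma decomp_sum (B : malg k m u) (S : set B) I (r : seq I) (P : pred I) (F : I -> B) :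
  (forall i, P i -> decomp S (F i)) -> decomp S (\sum_(i <- r | P i) F i).
Proof. by move=> h; elim/big_ind: _ => //; [exact: decomp0|exact: decompD]. Qed.
End Decomposables.

(** * Constant and linear parts *)

Section LinearPart.
Variables (k : fieldType) (m : nat) (u : bool) (M : variety k m u).
Hypothesis m_ge2 : (2 <= m)%N.

Definition pos X : set (free_alg M X) := hspan [set d | d <> 0].
Arguments pos : clear implicits.

Lemma sum_mdeg0 (X : Type) (I : finType) (d : I -> (X -> nat)) :
  \sum_i d i = 0 -> forall i, d i = 0.
Proof.
move=> d0 i; apply/funext => x; have := congr1 (fun f => f x) d0.
by rewrite fct_sumE => /eqP; rewrite sum_nat_eq0 => /forallP/(_ i)/eqP.
Qed.

Lemma mhomog0_const X d (c : free_alg M X) : mhomog d c -> d = 0 -> is_const c.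
Proof.
elim=> {d c} [x|h|d|d c a b _ IHa _ IHb|d v _ IH] d0.
- by have := congr1 (fun f => f x) d0; rewrite mdeg1.
- by right; exists h, 1; rewrite scale1r.
- by left.
- by apply: is_constD; [apply: is_constZ; exact: IHa|exact: IHb].
have dl := sum_mdeg0 d0.
have i : 'I_m := Ordinal m_ge2.
have [->|[c [j [-> _]]]] := mop_const (var_unital M) (IH i (dl i)); first by left.
exact/is_constZ/IH.
Qed.

Lemma const_mhomog X (c : free_alg M X) : is_const c -> mhomog 0 c.
Proof.
move=> [->|[h [e ->]]]; first exact: homog_zero.
exact/mhomogZ/(homog_one _ _ h).
Qed.

Lemma pos_const X (c : free_alg M X) : pos X c -> is_const c -> c = 0.
Proof. by move=> pc /const_mhomog hc; apply: (mhomog_neq hc pc) => /=; exact. Qed.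

Lemma const_pos X (a : free_alg M X) : exists c b, [/\ is_const c, pos X b & a = c + b].
Proof.
have [c [b [hc hb ->]]] := hspan_case [set 0] a.
exists c, b; split=> //; elim: hc => [|d x y d0 hx _ IH]; first by left.
by apply: is_constD => //; exact: mhomog0_const hx d0.
Qed.

(** A product of nonzero degree has a slot of nonzero degree, and one such slot keeps the image free
    of constant terms. *)
Lemma pos_lift X Y (f : X -> free_alg M Y) : (forall x, pos Y (f x)) ->
  forall a, pos X a -> pos Y (free_lift f a).
Proof.
move=> hf; have [fl fo f1] := lift_hom f.
apply: (hspan_lin fl); [exact: hspan0|exact: hspanD|] => d a /= + ha.
elim: ha => {d a} [x|h|d|d c a b _ IHa _ IHb|d v _ IH] d0.
- by rewrite lift_gen.
- by case: d0.
- by rewrite (lin0 fl); exact: hspan0.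
- by rewrite fl; apply: hspanD; [apply: hspanZ; exact: IHa|exact: IHb].
have [i di] : exists i, d i <> 0.
  by apply/not_existsP => h; apply: d0; rewrite big1 // => i _; apply: contrapT; exact: h.
rewrite fo; apply: (@hspan_mop _ _ _ _ _ (fun j => if j == i then [set e | e <> 0] else setT)).
  move=> e he /sum_mdeg0/(_ i) ei.
  by have := he i; rewrite eqxx.
by move=> j; case: eqP => [->|_]; [exact: IH|exact: hspan_all].
Qed.

(** A product whose factors all have nonzero degree is decomposable; a factor of degree zero is a
    constant, and [mop_const] then reduces to another factor. *)
Lemma linear_part (X : finType) (a : free_alg M X) : pos X a ->
  exists f : X -> k, decomp (pos X) (a - \sum_x f x *: gen M x).
Proof.
elim=> [|d {}a b d0 ha _ [g hg]].
  exists (fun=> 0); rewrite big1 ?subr0; first exact: decomp0.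
  by move=> x _; rewrite scale0r.
suff [f hf] : exists f : X -> k, decomp (pos X) (a - \sum_x f x *: gen M x).
  exists (fun x => f x + g x); under eq_bigr do rewrite scalerDl.
  by rewrite big_split opprD addrACA; exact: decompD.
elim: ha d0 => {d a b g hg} [x|h|d|d c a b _ IHa _ IHb|d v hv IH] d0.
- exists (fun y => (y == x)%:R); rewrite (bigD1 x) //= eqxx scale1r big1 ?addr0 ?subrr.
    exact: decomp0.
  by move=> y /negbTE ->; rewrite scale0r.
- by case: d0.
- exists (fun=> 0); rewrite big1 ?subr0; first exact: decomp0.
  by move=> x _; rewrite scale0r.
- have [[f hf] [g hg]] := (IHa d0, IHb d0); exists (fun x => c * f x + g x).
  under eq_bigr do rewrite scalerDl -scalerA.
  rewrite big_split -scaler_sumr opprD addrACA -scalerBr; exact: decomp_lin.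
case: (pselect (exists i, d i = 0)) => [[i di]|dn0].
  have := mop_const (var_unital M) (mhomog0_const (hv i) di).
  move=> [->|[c [j [-> /(_ _ d di) dj]]]].
    exists (fun=> 0); rewrite big1 ?subr0; first exact: decomp0.
    by move=> x _; rewrite scale0r.
  have [|f hf] := IH j; first by rewrite -dj.
  exists (fun x => c * f x); under eq_bigr do rewrite -scalerA.
  by rewrite -scaler_sumr -scalerBr; exact: decompZ.
exists (fun=> 0); rewrite big1 ?subr0 => [|x _]; last by rewrite scale0r.
apply: decomp_mop => i; apply: (hspan_homog _ (hv i)) => /= di.
by apply: dn0; exists i.
Qed.

(** Each of the [m >= 2] factors contributes at least 1 to the degree. *)
Lemma decomp_tdeg (X : finType) (S : set (free_alg M X)) a :
  S `<=` pos X -> decomp S a -> hspan [set e | 1 < tdeg e]%N a.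
Proof.
move=> Spos; elim=> [|c x y _ hx _ hy|v Sv]; first exact: hspan0.
  by apply: hspanD hy; exact: hspanZ.
apply: hspan_mop (fun i => Spos _ (Sv i)) => d hd /=.
rewrite /tdeg wdeg_sum; apply: (leq_trans m_ge2).
rewrite -[X in (X <= _)%N]card_ord -sum1_card; apply: leq_sum => i _.
exact/tdeg_gt0/hd.
Qed.
End LinearPart.

(** * Free families in free subalgebras *)

Section FreeFamilies.
Variables (k : fieldType) (m : nat) (u : bool) (M : variety k m u).
Hypothesis m_ge2 : (2 <= m)%N.

Lemma finite_support (Y : Type) (a : free_alg M Y) : exists L : seq {classic Y},
  forall (B : malg k m u) (v v' : Y -> B),
    (forall y : {classic Y}, y \in L -> v y = v' y) -> free_lift v a = free_lift v' a.
Proof.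
rewrite /free_lift; elim: (rep a) => /= [y|h||s [L hL] t [L' hL']|c t [L hL]|ts IH].
- by exists [:: (y : {classic Y})] => B v v'; apply; rewrite inE.
- by exists [::].
- by exists [::].
- exists (L ++ L') => B v v' h; rewrite (hL B v v') ?(hL' B v v') // => y yL;
    by apply: h; rewrite mem_cat yL ?orbT.
- by exists L => B v v' h; rewrite (hL B v v').
pose L i := sval (cid (IH i)); exists (flatten [seq L i | i <- enum 'I_m]) => B v v' h.
congr mop; apply/funext => i; apply: (svalP (cid (IH i))) => y yL.
by apply: h; apply/flatten_mapP; exists i; rewrite ?mem_enum.
Qed.

(** Only finitely many generators occur in the [c i]. Passing to them lets the linear parts be
    arranged in a matrix. *)
Lemma finite_reduction (Y : Type) (I : finType) (c : I -> free_alg M Y) :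
  exists (r : nat) (j : 'I_r -> Y) (c' : I -> free_alg M 'I_r),
    injective (free_lift (fun l => gen M (j l)) : free_alg M 'I_r -> free_alg M Y) /\
    forall i, free_lift (fun l => gen M (j l)) (c' i) = c i.
Proof.
pose L i := sval (cid (finite_support (c i))).
pose L0 := undup (flatten [seq L i | i <- enum I]).
pose j (l : 'I_(size L0)) : {classic Y} := tnth (in_tuple L0) l.
have j_inj : injective j.
  move=> l l' /eqP; rewrite /j !(tnth_nth (j l)) nth_uniq ?undup_uniq //.
  by move/eqP => e; apply/val_inj.
(* A left inverse of the inclusion of the finitely many generators: all others go to 0. *)
pose s (y : Y) : free_alg M 'I_(size L0) :=
  if pselect (exists l, j l = y) is left e then gen M (sval (cid e)) else 0.
have sj l : s (j l) = gen M l.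
  rewrite /s; case: pselect => [e|]; last by case; exists l.
  by congr gen; apply: j_inj; exact: (svalP (cid e)).
pose J : free_alg M 'I_(size L0) -> free_alg M Y := free_lift (fun l => gen M (j l)).
have sJ a : free_lift s (J a) = a.
  rewrite hom_lift; last exact: lift_hom.
  rewrite -[RHS]lift_id; congr free_lift; apply/funext => l /=.
  by rewrite lift_gen sj.
exists (size L0), j, (fun i => free_lift s (c i)); split.
  by move=> a b ab; rewrite -(sJ a) -(sJ b); congr free_lift.
move=> i; rewrite hom_lift; last exact: lift_hom.
rewrite -[RHS]lift_id; apply: (svalP (cid (finite_support (c i)))) => y yL /=.
have yL0 : y \in L0.
  by rewrite mem_undup; apply/flatten_mapP; exists i; rewrite ?mem_enum.
have -> : y = j (Ordinal (introT idP (etrans (index_mem y L0) yL0))).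
  by rewrite /j (tnth_nth y) /= nth_index.
by rewrite sj lift_gen.
Qed.

Lemma comp_hom (B B' B'' : malg k m u) (f : B' -> B'') (g : B -> B') :
  is_hom f -> is_hom g -> is_hom (f \o g).
Proof.
move=> [fl fo f1] [gl go g1]; split=> [c a b|v|h] /=.
- by rewrite gl fl.
- by rewrite go fo.
- by rewrite g1 f1.
Qed.

(** Homomorphisms preserve constants, so the constant term of [h (gen M y)] lifts to a constant
    [c y], and [y |-> y - c y] is an automorphism with inverse [y |-> y + c y]. *)
Lemma range_free_pos (X Y : Type) (h : free_alg M Y -> free_alg M X) :
  is_hom h -> injective h -> exists2 q : free_alg M Y -> free_alg M Y,
    [/\ is_hom q, bijective q & range (h \o q) = range h]
    & forall y, pos (h (q (gen M y))).
Proof.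
move=> hh h_inj; have [hl ho h1] := hh.
have /choice[c hc] y : exists c : free_alg M Y,
    is_const c /\ pos (h (gen M y) - h c).
  have [c [b [hc hb hy]]] := const_pos m_ge2 (h (gen M y)).
  case: hc => [c0|[e [a ca]]].
    by exists 0; split; [left|rewrite (lin0 hl) subr0 hy c0 add0r].
  exists (a *: mone e); split; first by right; exists e, a.
  by rewrite hy ca (linZ hl) h1 addrC addKr.
pose q : free_alg M Y -> free_alg M Y := free_lift (fun y => gen M y - c y).
pose q' : free_alg M Y -> free_alg M Y := free_lift (fun y => gen M y + c y).
have [ql qo q1] : is_hom q by exact: lift_hom.
have [ql' qo' q1'] : is_hom q' by exact: lift_hom.
have fixc (f : free_alg M Y -> free_alg M Y) y : is_hom f -> f (c y) = c y.
  move=> [fl fo f1]; case: (hc y) => -[->|[e [a ->]]] _; first exact: lin0.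
  by rewrite (linZ fl) f1.
have qq' : cancel q q'.
  move=> a; rewrite /q hom_lift; last exact: lift_hom.
  rewrite -[RHS]lift_id; congr free_lift; apply/funext => y /=.
  by rewrite (linB ql') (fixc q') // [q' _]lift_gen addrK.
have q'q : cancel q' q.
  move=> a; rewrite /q' hom_lift; last exact: lift_hom.
  rewrite -[RHS]lift_id; congr free_lift; apply/funext => y /=.
  by rewrite (linD ql) (fixc q) // [q _]lift_gen subrK.
exists q; last by move=> y; rewrite /q lift_gen (linB hl); case: (hc y).
split; [exact: lift_hom|by exists q'|].
apply/seteqP; split=> [_ [a _ <-]|_ [a _ <-]]; first by exists (q a).
by exists (q' a) => //=; rewrite q'q.
Qed.

(* The left inverse of [free_lift b] up to higher degree comes from a right
   inverse of the matrix of linear parts of the [b i] in the free generators of [B]. *)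
Lemma free_indep (X : Type) (B : set (free_alg M X)) (I : finType) (b : I -> free_alg M X) :
  free_in M B -> (forall i, B (b i)) -> (forall i, pos (b i)) ->
  (forall a : I -> k, decomp (B `&` @pos _ _ _ M X) (\sum_i a i *: b i) ->
     forall i, a i = 0) ->
  injective (free_lift b : free_alg M I -> free_alg M X).
Proof.
move=> [Y0 [h0 [h0h h0_inj h0B]]] Bb posb indep.
have /choice[c0 hc0] i : exists c, h0 c = b i.
  by have := Bb i; rewrite -h0B => -[c _ <-]; exists c.
have [r [j [c1 [j_inj c1c0]]]] := finite_reduction c0.
set J : free_alg M 'I_r -> free_alg M Y0 := free_lift _ in j_inj.
have Jh : is_hom J by exact: lift_hom.
have h1h : is_hom (h0 \o J) by exact: comp_hom.
have h1_inj : injective (h0 \o J) by exact: inj_comp.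
have [q [qh [q' qq' q'q] _] hq] := range_free_pos h1h h1_inj.
pose h := h0 \o J \o q; have hh : is_hom h by exact: comp_hom.
have [hl ho h1] := hh.
have h_inj : injective h by apply: inj_comp => //; exact: can_inj qq'.
have hB a : B (h a) by rewrite -h0B; exists (J (q a)).
pose c i := q' (c1 i).
have hc i : h (c i) = b i by rewrite /h /c /= q'q /J c1c0 hc0.
have hpos a : pos a -> pos (h a).
  by rewrite (hom_gen _ hh); apply: pos_lift.
(* The constant part of [c i] is sent by [h] to a constant that has no constant term, hence to 0. *)
have cpos i : pos (c i).
  have [e [d [he hd cE]]] := const_pos m_ge2 (c i).
  rewrite cE (_ : e = 0) ?add0r //; apply: h_inj; rewrite (lin0 hl).
  apply: pos_const (is_const_hom hh he) => //.
  have -> : h e = b i - h d by rewrite -hc cE (linD hl) addrK.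
  by apply: hspanB; [exact: posb|exact: hpos].
have /choice[f hf] i := linear_part m_ge2 (cpos i).
pose F : 'M[k]_(#|I|, r) := \matrix_(i, l) f (enum_val i) l.
(* A relation between the rows cancels the linear parts, so the same combination of the [b i] is the
   image of a decomposable element, and [indep] applies. *)
have F_free : row_free F.
  apply: inj_row_free => v vF; apply/rowP => i0; rewrite mxE.
  rewrite -(enum_valK i0).
  apply: (indep (fun i => v 0 (enum_rank i))).
  have -> : \sum_i v 0 (enum_rank i) *: b i =
      h (\sum_i v 0 (enum_rank i) *: (c i - \sum_x f i x *: gen M x)).
    rewrite (lin_sum hl) -[LHS]subr0.
    under [X in _ = X]eq_bigr do rewrite (linZ hl) (linB hl) hc scalerBr.
    rewrite sumrB; congr (_ - _); apply/esym.
    under eq_bigr do rewrite -(linZ hl) scaler_sumr.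
    rewrite -(lin_sum hl) exchange_big /= big1 ?(lin0 hl) // => x _.
    under eq_bigr do rewrite scalerA.
    rewrite -scaler_suml (_ : \sum_i _ = 0) ?scale0r //.
    have := congr1 (fun A : 'rV_r => A 0 x) vF; rewrite !mxE => e; rewrite -[RHS]e.
    rewrite (reindex_onto (enum_rank : I -> _) enum_val) /=; last by move=> ? _; exact: enum_valK.
    apply: eq_big => [i|i _]; first by rewrite enum_rankK eqxx.
    by rewrite !mxE enum_rankK.
  apply: (decomp_hom (S := @pos _ _ _ M 'I_r)) => //.
    by move=> x px; split; [exact: hB|exact: hpos].
  by apply: decomp_sum => i _; apply: decompZ; exact: hf.
(* The rows of [F] are independent, so [G] is a right inverse, and the map [p] built from it sends
   the linear part of [c i] to the generator [i]. *)
pose G := pinvmx F; have FG : F *m G = 1%:M by exact: mulmxVp.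
pose p : free_alg M 'I_r -> free_alg M I :=
  free_lift (fun l => \sum_i G l (enum_rank i) *: gen M i).
have [pl po p1] : is_hom p by exact: lift_hom.
have ppos a : pos a -> pos (p a).
  apply: pos_lift => l; apply: hspan_sum => i _; apply/hspanZ.
  apply: (hspan_homog _ (homog_gen _ _ i)) => /(congr1 (fun f => f i)).
  by rewrite mdeg1.
have pc i : hspan [set e | 1 < tdeg e]%N (p (c i) - gen M i).
  have -> : gen M i = p (\sum_x f i x *: gen M x).
    rewrite (lin_sum pl); under eq_bigr do rewrite (linZ pl) [p _]lift_gen scaler_sumr.
    rewrite exchange_big /= (bigD1 i) //= [X in _ + X]big1 ?addr0.
      under eq_bigr do rewrite scalerA.
      rewrite -scaler_suml (_ : \sum_x _ = 1) ?scale1r //.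
      have := congr1 (fun A : 'M_#|I| => A (enum_rank i) (enum_rank i)) FG.
      rewrite !mxE eqxx => e; rewrite -[RHS]e.
      by apply: eq_bigr => x _; rewrite [F _ _]mxE enum_rankK.
    move=> i' i'i; under eq_bigr do rewrite scalerA.
    rewrite -scaler_suml (_ : \sum_x _ = 0) ?scale0r //.
    have := congr1 (fun A : 'M_#|I| => A (enum_rank i) (enum_rank i')) FG.
    rewrite !mxE (inj_eq enum_rank_inj) eq_sym (negbTE i'i) => e; rewrite -[RHS]e.
    by apply: eq_bigr => x _; rewrite [F _ _]mxE enum_rankK.
  rewrite -(linB pl); apply: (decomp_tdeg m_ge2 (S := @pos _ _ _ M I)) => //.
  by apply: decomp_hom (hf i); [exact: lift_hom|].
(* [p] after [free_lift c] is the identity up to higher degree; its injectivity forces that of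
   [free_lift c]. *)
have pc_inj := unip_inj pc.
have bE (a : free_alg M I) : free_lift b a = h (free_lift c a).
  rewrite hom_lift //; congr free_lift; apply/funext => i /=; exact/esym/hc.
move=> x y; rewrite !bE => /h_inj xy; apply: pc_inj.
have e (z : free_alg M I) : free_lift (fun i => p (c i)) z = p (free_lift c z).
  by rewrite hom_lift //; exact: lift_hom.
by rewrite !e xy.
Qed.
End FreeFamilies.

(** * The action of the enveloping algebra *)

Section Action.
Variables (k : fieldType) (m : nat) (u : bool) (M : variety k m u) (n : nat).
Local Notation A := (free_alg M 'I_n).
Local Notation C := (free_alg M ('I_n + 'I_n)%type).

Lemma mult_op_hom (B B' : malg k m u) (g : B -> B') i b a : is_hom g ->
  g (mult_op i b a) = mult_op i (g \o b) (g a).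
Proof.
move=> [_ go _]; rewrite /mult_op go; congr mop; apply/funext => j /=.
by case: unliftP.
Qed.

(* An element [w] of [Ae] is encoded by the element [w y] of the free algebra on the
   [x_i] and one more generator [y = gen None]. *)
Definition act X (t : free_alg M (option 'I_n)) (f : 'I_n -> free_alg M X)
  (a : free_alg M X) : free_alg M X := free_lift (oapp f a) t.

Lemma act_hom X Y (g : free_alg M X -> free_alg M Y) t f a : is_hom g ->
  g (act t f a) = act t (g \o f) (g a).
Proof.
by move=> gh; rewrite /act hom_lift //; congr free_lift; apply/funext => -[].
Qed.

(** Induction on the generation of [w]: an operator [U i b] is encoded by the product of [y] with
    the [b] in the other slots, sums and multiples by sums and multiples. *)
Lemma Ae_act_exists (w : Ae M n) : exists t : free_alg M (option 'I_n),
  (forall o, (w o : C) = act t (fun i => gen M (inl i)) o) /\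
  forall X (f : 'I_n -> free_alg M X), in_opalg (@mult_gens _ _ _ _) (act t f).
Proof.
elim: (opfunP w) => {w}
  [|_ [i [b ->]]|f g _ [s [hs sX]] _ [t [ht tX]]|c f _ [t [ht tX]]
  |f g _ [s [hs sX]] _ [t [ht tX]]].
- exists (gen M None); split=> [o|X f]; first by rewrite /act lift_gen.
  have -> : act (gen M None) f = id by apply/funext => a; rewrite /act lift_gen.
  exact: opalg_id.
- exists (mult_op i (free_lift (fun j => gen M (Some j)) \o b) (gen M None)).
  have H X (f : 'I_n -> free_alg M X) a :
      act (mult_op i (free_lift (fun j => gen M (Some j)) \o b) (gen M None)) f a =
      mult_op i (free_lift f \o b) a.
    rewrite /act mult_op_hom; last exact: lift_hom.
    rewrite lift_gen; congr mult_op; apply/funext => j /=.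
    rewrite hom_lift; last exact: lift_hom.
    rewrite (_ : _ \o _ = f) //; apply/funext => l /=; exact: lift_gen.
  split=> [o|X f]; first by rewrite H.
  by rewrite (funext (H X f)); exact: mult_op_in.
- have H X (h : 'I_n -> free_alg M X) a : act (s + t) h a = act s h a + act t h a.
    by rewrite /act; have [l _ _] := lift_hom (oapp h a); rewrite (linD l).
  exists (s + t); split=> [o|X h]; first by rewrite H -hs -ht.
  by rewrite (funext (H X h)); exact: opalg_add.
- have H X (h : 'I_n -> free_alg M X) a : act (c *: t) h a = c *: act t h a.
    by rewrite /act; have [l _ _] := lift_hom (oapp h a); rewrite (linZ l).
  exists (c *: t); split=> [o|X h]; first by rewrite H -ht.
  by rewrite (funext (H X h)); exact: opalg_scale.
(* Composition is encoded by substituting [t] for [y] in [s]. *)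
pose st := act s (fun j => gen M (Some j)) t.
have H X (h : 'I_n -> free_alg M X) a : act st h a = act s h (act t h a).
  rewrite {1}/act /st act_hom; last exact: lift_hom.
  by congr act; apply/funext => j /=; rewrite lift_gen.
exists st; split=> [o|X h]; first by rewrite H -ht -hs.
by rewrite (funext (H X h)); exact: opalg_comp.
Qed.

Definition Ae_code (w : Ae M n) : free_alg M (option 'I_n) :=
  sval (cid (Ae_act_exists w)).

Lemma Ae_codeE (w : Ae M n) (o : Omega_mod M n) : (w o : C) = act (Ae_code w) (fun i => gen M (inl i)) o.
Proof. exact: (svalP (cid (Ae_act_exists w))).1. Qed.

Lemma Ae_code_opalg w X (f : 'I_n -> free_alg M X) :
  in_opalg (@mult_gens _ _ _ _) (act (Ae_code w) f).
Proof. exact: (svalP (cid (Ae_act_exists w))).2. Qed.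

Lemma Ae_code_eq0 w : Ae_code w = 0 -> w = 0.
Proof.
move=> w0; apply: opalg_eqP => o; apply/val_inj; rewrite [LHS]Ae_codeE w0 /act.
have [l _ _] := lift_hom (oapp (fun i => gen M (inl i)) (o : C)).
by rewrite (lin0 l) /= scale0r.
Qed.

Definition Ae_act (w : Ae M n) (a : A) : A := act (Ae_code w) (gen M (X := 'I_n)) a.

Definition subst_y (G : 'I_n -> A) : C -> A :=
  free_lift (fun z => match z with inl i => gen M i | inr i => G i end).

Lemma subst_y_hom G : is_hom (subst_y G). Proof. exact: lift_hom. Qed.

Lemma subst_y_act G (w : Ae M n) (o : Omega_mod M n) : subst_y G (w o) = Ae_act w (subst_y G o).
Proof.
rewrite Ae_codeE act_hom; last exact: subst_y_hom.
by congr act; apply/funext => i /=; rewrite /subst_y lift_gen.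
Qed.

Lemma subst_y_gen G i : subst_y G (ygen M i) = G i.
Proof. exact: lift_gen. Qed.

Lemma subst_y_incl G a : subst_y G (Defs.incl a) = a.
Proof.
rewrite /Defs.incl hom_lift; last exact: subst_y_hom.
rewrite -[RHS]lift_id; congr free_lift; apply/funext => i.
exact: lift_gen.
Qed.

Lemma Ae_act_linear w : linear (Ae_act w).
Proof. exact: opalg_linear (mk_op (Ae_code_opalg w (gen M (X := 'I_n)))). Qed.

Section Module.
Variable i : 'I_n.

(** Codes are chosen arbitrarily, so their compatibility with sums and products is not immediate.
    This formula depends on [w] only as an operator and yields the module laws; the index [i]
    provides a variable [y_i] to act on. *)
Lemma Ae_actE w a : Ae_act w a = subst_y (fun=> a) (w (ygen M i)).
Proof. by rewrite subst_y_act subst_y_gen. Qed.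

Lemma Ae_act0 a : Ae_act 0 a = 0.
Proof.
have [l _ _] := subst_y_hom (fun=> a).
by rewrite Ae_actE /= scale0r (lin0 l).
Qed.

Lemma Ae_actD w w' a : Ae_act (w + w') a = Ae_act w a + Ae_act w' a.
Proof.
have [l _ _] := subst_y_hom (fun=> a).
by rewrite !Ae_actE /= (linD l).
Qed.

Lemma Ae_act1 a : Ae_act 1 a = a.
Proof. by rewrite Ae_actE /= subst_y_gen. Qed.

Lemma Ae_actM w w' a : Ae_act (w * w') a = Ae_act w (Ae_act w' a).
Proof. by rewrite [LHS]Ae_actE /= subst_y_act -Ae_actE. Qed.

Lemma Ae_act_sum I (r : seq I) (P : pred I) (F : I -> Ae M n) a :
  Ae_act (\sum_(j <- r | P j) F j) a = \sum_(j <- r | P j) Ae_act (F j) a.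
Proof.
exact: (big_morph (fun w => Ae_act w a) (fun w w' => Ae_actD w w' a) (Ae_act0 a)).
Qed.
End Module.

(** The chain rule: applying [OmegaD] and then [y_j |-> E x_j] is a derivation of [A] that agrees
    with [E] on generators. *)
Lemma der_fox (E : der A) (b : A) :
  E b = \sum_(j < n) Ae_act (fox b j) (E (gen M j)).
Proof.
pose G j := E (gen M j); have [rl ro r1] := subst_y_hom G.
have [il io _] := @incl_hom k m u M n.
have [dl dL] := derP (OmegaD M n).
have dD : is_derivation (fun a : A => subst_y G (OmegaD M n (Defs.incl a))).
  split=> [c a a'|v]; first by rewrite il dl rl.
  rewrite io dL (lin_sum rl); apply: eq_bigr => j _.
  rewrite ro; congr mop; apply/funext => l /=; rewrite /put.
  by case: eqP => // _; rewrite /= subst_y_incl.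
have -> : E b = subst_y G (OmegaD M n (Defs.incl b)).
  pose E' : der A := Der (asboolT dD : _ \in @der_pred _ _ _ A).
  suff -> : E = E' by [].
  apply: der_eq => j /=; rewrite /Defs.incl lift_gen der_of_gen.
  by rewrite (subst_y_gen G j).
rewrite foxP (lin_sum rl); apply: eq_bigr => j _.
by rewrite subst_y_act subst_y_gen.
Qed.

(** The product of [E] and [D] sends [x_i] to [E (D x_i)], which [der_fox] expands along row [i] of
    the Jacobian matrix; iterating multiplies by this matrix. *)
Lemma rmult_exp (D E : LA M n) s i :
  (((rmult D ^+ s) E : LA M n) : der A) (gen M i) =
  \sum_(j < n) Ae_act ((jacobian D ^+ s) i j) ((E : der A) (gen M j)).
Proof.
elim: s i => [|s IH] i.
  rewrite !expr0 /= (bigD1 i) //= big1 ?addr0.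
    by rewrite -[1]/(1%:M) mxE eqxx mulr1n Ae_act1.
  move=> j ji; rewrite -[1]/(1%:M) mxE eq_sym (negbTE ji) mulr0n.
  exact: Ae_act0 i _.
rewrite !exprS.
have -> : (rmult D * rmult D ^+ s) E = der_mul ((rmult D ^+ s) E) D.
  exact: rmultE.
rewrite /der_mul der_of_gen der_fox.
under eq_bigr => l _ do rewrite IH (lin_sum (Ae_act_linear _)).
rewrite exchange_big /=; apply: eq_bigr => j _.
rewrite -[jacobian D * _]/(jacobian D *m _) mxE (Ae_act_sum i).
by apply: eq_bigr => l _; rewrite (Ae_actM i) mxE.
Qed.

Lemma jacobian_nilpotent_rmult (D : LA M n) :
  nilpotent_elt (jacobian D) -> nilpotent_elt (rmult D).
Proof.
move=> [s J0]; exists s; apply: opalg_eqP => E; apply: der_eq => i.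
rewrite rmult_exp J0 big1 /= ?scale0r // => j _.
by rewrite mxE (Ae_act0 i).
Qed.

Lemma rmult_nilpotent_jacobian (D : LA M n) :
  (forall s i j, (forall a, Ae_act ((jacobian D ^+ s) i j) a = 0) ->
     (jacobian D ^+ s) i j = 0) ->
  nilpotent_elt (rmult D) -> nilpotent_elt (jacobian D).
Proof.
move=> faith [s R0]; exists s; apply/matrixP => i j; rewrite [RHS]mxE.
(* The derivation [partial a j] has [a] as its only possibly nonzero coordinate and so isolates the
   entry [(i, j)]. *)
apply: faith => a; have := rmult_exp D (partial a j) s i.
rewrite R0 /= scale0r (bigD1 j) //= big1 => [|l lj]; rewrite der_of_gen.
  by rewrite eqxx addr0 => <-.
by rewrite (negbTE lj) (lin0 (Ae_act_linear _)).
Qed.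

End Action.

(** * Faithfulness *)

Section Faithfulness.
Variables (k : fieldType) (m : nat) (u : bool) (M : variety k m u) (n : nat).
Local Notation A := (free_alg M 'I_n).

(** Multiplication operators do not lower degrees, since the other factors have degree at least
    0. *)
Lemma opalg_tdeg (X : finType) (f : free_alg M X -> free_alg M X) N a :
  in_opalg (@mult_gens _ _ _ _) f ->
  hspan [set e | N <= tdeg e]%N a -> hspan [set e | N <= tdeg e]%N (f a).
Proof.
move=> hf; elim: hf a => {f} [//|_ [i [b ->]]|f g _ Hf _ Hg|c f _ Hf|f g _ Hf _ Hg] a ha.
- apply: (@hspan_mop _ _ _ _ _
    (fun j => if j == i then [set e | N <= tdeg e]%N else setT)) => [e he|j].
    rewrite /= /tdeg wdeg_sum (bigD1 i) //=; have := he i; rewrite eqxx => /leq_trans.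
    by apply; exact: leq_addr.
  case: unliftP => [l ->|->] /=; last by rewrite eqxx.
  by rewrite eq_sym (negbTE (neq_lift _ _)); exact: hspan_all.
- by apply: hspanD; [exact: Hf|exact: Hg].
- by apply: hspanZ; exact: Hf.
- by rewrite /=; apply: Hf; exact: Hg.
Qed.

Definition replace_gen (i : 'I_n) (z : A) (j : 'I_n) : A :=
  if j == i then z else gen M j.

(* If [t] kills [A], the substitution [x_i |-> x_i + z] shows that
   [t(x_1, .., x_i + z, .., x_n, a) = 0] as well for every [a]; its top degree part
   is [t(x_1, .., z, .., x_n, a)]. *)
Lemma act_eq0 (t : free_alg M (option 'I_n)) (i : 'I_n) (z b : A) (dz db : nat) :
  (forall f : 'I_n -> A, in_opalg (@mult_gens _ _ _ _) (act t f)) ->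
  (forall a : A, act t (gen M (X := 'I_n)) a = 0) ->
  (2 <= dz)%N -> hspan [set e | tdeg e = dz] z -> hspan [set e | tdeg e = db] b ->
  injective (free_lift (oapp (replace_gen i z) b) : free_alg M (option 'I_n) -> A) ->
  t = 0.
Proof.
move=> top t0 dz2 hz hb p_inj.
pose q := replace_gen i (gen M i + z).
have hq j : hspan [set e | 1 < tdeg e]%N (q j - gen M j).
  rewrite /q /replace_gen; case: eqP => [->|_]; last by rewrite subrr; exact: hspan0.
  by rewrite addrC addKr; apply: hspan_sub hz => e /= ->.
have Wl : linear (act t q) by exact: opalg_linear (mk_op (top q)).
(* The endomorphism given by [q] carries the vanishing of [t] at the generators to its vanishing on
   the image of [q]. Every [a] lies in this image up to arbitrarily high degree, which the operator
   does not lower. *)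
have W0 a : act t q a = 0.
  apply: hspan_ge0 => N; have [b' hb'] := unip_dense hq N a.
  have -> : act t q a = act t q (a - free_lift q b').
    rewrite (linB Wl) [X in _ - X](_ : _ = 0) ?subr0 //.
    have := act_hom t (gen M (X := 'I_n)) b' (lift_hom q); rewrite t0.
    have [ql _ _] := lift_hom q; rewrite (lin0 ql) => ->.
    by congr act; apply/funext => j /=; rewrite lift_gen.
  exact: opalg_tdeg.
pose p := oapp (replace_gen i z) b; pose p' := oapp q b.
(* The weight of a generator is the degree of its image under [p]; its image under [p'] differs by
   terms of lower degree. *)
pose w (o : option 'I_n) := if o is Some j then if j == i then dz else 1%N else db.
have hp o : hspan [set e | tdeg e = w o] (p o).
  case: o => [j|] //=; rewrite /replace_gen; case: eqP => // _; exact: gen_tdeg1.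
have hp' o : hspan [set e | tdeg e < w o]%N (p' o - p o).
  case: o => [j|] /=; last by rewrite subrr; exact: hspan0.
  rewrite /q /replace_gen; case: eqP => _; last by rewrite subrr; exact: hspan0.
  by rewrite addrK; apply: hspan_sub (gen_tdeg1 M i) => e /= ->.
have [pl _ _] := lift_hom p; have [pl' _ _] := lift_hom p'.
have P0 d (c : free_alg M (option 'I_n)) : mhomog d c -> hspan [set e | tdeg e = wdeg w d] (free_lift p c).
  by move=> hc; exact: (lift_graded hp hc).
have P1 d (c : free_alg M (option 'I_n)) : mhomog d c ->
    hspan [set e | tdeg e < wdeg w d]%N (free_lift p' c - free_lift p c).
  by move=> hc; apply: (lift_perturb (R := fun x y => (x < y)%N) _ hp hp' hc) => *; lia.
(* Split off the part [g1] of top weight [N]. Its image under [p] has degree [N], and all remaining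
   terms of the image of [g] under [p'] have lower degree, so [p] kills [g1]. *)
have top0 N (g : free_alg M (option 'I_n)) : hspan [set e | wdeg w e < N]%N g -> free_lift p' g = 0 -> g = 0.
  elim: N g => [|N IH] g hg g0; first by apply: (hspan_disj _ hg hg) => e.
  have /hspan_split[g1 [g2 [h1 h2 gE]]] :
      hspan ([set e | wdeg w e = N] `|` [set e | wdeg w e < N]%N) g.
    by apply: hspan_sub hg => e /=; rewrite ltnS leq_eqVlt => /orP[/eqP|]; [left|right].
  suff g10 : g1 = 0.
    have ge : g = g2 by rewrite gE g10 add0r.
    by apply: IH => //; rewrite ge.
  apply: p_inj; rewrite (lin0 pl).
  apply: (@hspan_disj _ _ _ _ _ [set e | tdeg e = N] [set e | tdeg e < N]%N).
  - by move=> e /= ->; rewrite ltnn.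
  - move: h1; apply: (hspan_lin pl); [exact: hspan0|exact: hspanD|].
    by move=> d c /= <-; exact: P0.
  have -> : free_lift p g1 = - ((free_lift p' g1 - free_lift p g1) + free_lift p' g2).
    by rewrite addrAC -(linD pl') -gE g0 sub0r opprK.
  apply/hspanN/hspanD.
    move: h1; apply: (hspan_lin (L := fun c => free_lift p' c - free_lift p c)).
    - by move=> c x y; rewrite pl pl' opprD addrACA -scalerBr.
    - exact: hspan0.
    - exact: hspanD.
    by move=> d c /= <-; exact: P1.
  move: h2; apply: (hspan_lin pl'); [exact: hspan0|exact: hspanD|].
  move=> d c /= dN hc; rewrite -(subrK (free_lift p c) (free_lift p' c)).
  apply: hspanD; first by apply: hspan_sub (P1 d c hc) => e /= /ltn_trans; exact.
  by apply: hspan_sub (P0 d c hc) => e /= ->.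
have [N hN] := hspan_bounded w t.
exact: top0 hN (W0 b).
Qed.
End Faithfulness.

(** * Replacing a generator by a monomial *)

Section GeneratorReplacement.
Variables (k : fieldType) (m : nat) (u : bool) (M : variety k m u) (n : nat).
Hypotheses (m_ge2 : (2 <= m)%N) (NS : Nielsen_Schreier M).
Local Notation A := (free_alg M 'I_n).

(** The part of [a] with degrees in [P] but not in [Q] also lies in the span for [Q], hence
    vanishes. *)
Lemma hspan_setI X (P Q : set (X -> nat)) (a : free_alg M X) :
  hspan P a -> hspan Q a -> hspan (P `&` Q) a.
Proof.
move=> hP hQ; have /hspan_split[b [c [hb hc aE]]] : hspan ((P `&` Q) `|` (P `\` Q)) a.
  by apply: hspan_sub hP => d Pd; case: (pselect (Q d)) => Qd; [left|right].
rewrite aE (_ : c = 0) ?addr0 //.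
apply: (@hspan_disj _ _ _ _ _ Q (P `\` Q)) => // [d Qd [_]//|].
have -> : c = a - b by rewrite aE addrC addKr.
by apply: hspanB => //; apply: hspan_sub hb => d [].
Qed.

Lemma tdeg_mdeg (d : 'I_n -> nat) i : tdeg d = 1%N -> d i <> 0%N -> d = mdeg i.
Proof.
move=> d1 /eqP di; apply/funext => j.
have := d1; rewrite /tdeg /wdeg (bigD1 i) //= mul1n.
case: (eqVneq j i) => [->|ji]; first by rewrite mdeg1; lia.
rewrite mdeg_neq; last by move=> ij; rewrite ij eqxx in ji.
by rewrite (bigD1 j) //= mul1n; lia.
Qed.

Definition no_linear (i : 'I_n) : set A := hspan [set e | e <> mdeg i].

Lemma no_linear_subalgebra i : is_subalgebra (no_linear i).
Proof.
split=> [|c a b ha hb|v hv|h].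
- exact: hspan0.
- by apply: hspanD => //; exact: hspanZ.
(* If the degrees add up to that of [x_i], then a slot involving [x_i] already has this degree. Such
   a slot exists, so the default index is never reached. *)
- apply: hspan_mop hv => d hd e; apply: (hd (odflt (Ordinal m_ge2) [pick l | d l i != 0%N])).
  have di1 : (\sum_l d l i)%N = 1%N.
    by rewrite -(mdeg1 i) -e fct_sumE.
  case: pickP => [l dl|d0] /=; last by move: di1; rewrite big1 // => l _; apply/eqP/negbFE/d0.
  apply/funext => j; apply/eqP; rewrite eqn_leq; apply/andP; split.
    by rewrite -e fct_sumE (bigD1 l) //= leq_addr.
  by rewrite /mdeg; case: asboolP => // <-; rewrite lt0n.
apply: (hspan_homog _ (homog_one _ _ h)) => /= /(congr1 (fun f => f i)).
by rewrite mdeg1.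
Qed.

(** Up to terms of other degrees, [a j *: b j] is the component of degree [d j], which the span for
    [Q] does not have. *)
Lemma distinct_degrees (I : finType) (d : I -> ('I_n -> nat)) (b : I -> A) Q :
  injective d -> (forall j, mhomog (d j) (b j)) -> (forall j, b j != 0) ->
  (forall j, ~ Q (d j)) -> forall a : I -> k,
  hspan Q (\sum_j a j *: b j) -> forall j, a j = 0.
Proof.
move=> d_inj hb b0 nQ a hs j.
suff : a j *: b j = 0 by move/eqP; rewrite scaler_eq0 (negbTE (b0 j)) orbF => /eqP.
apply: (@mhomog_neq _ _ _ _ _ [set e | e <> d j] (d j)) => [||/=].
- exact/mhomogZ/hb.
- have -> : a j *: b j = \sum_j a j *: b j - \sum_(l | l != j) a l *: b l.
    by rewrite [X in _ = X - _](bigD1 j) //= addrK.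
  apply: hspanB; first by apply: hspan_sub hs => e Qe ej; apply: (nQ j); rewrite -ej.
  apply: hspan_sum => l lj; apply/hspanZ/(hspan_homog _ (hb l)) => /= /d_inj lj'.
  by rewrite lj' eqxx in lj.
- exact.
Qed.

Variable v : 'I_m -> 'I_n.
Let z : A := mop (fun l => gen M (v l)).
Hypothesis z_neq0 : z != 0.
Let dz : 'I_n -> nat := \sum_l mdeg (v l).

Lemma monomial_homog : mhomog dz z.
Proof. by apply: homog_op => l; exact: homog_gen. Qed.

Lemma monomial_tdeg : tdeg dz = m.
Proof.
rewrite /tdeg wdeg_sum; under eq_bigr do rewrite wdeg_mdeg.
by rewrite sum1_card card_ord.
Qed.

Lemma monomial_degE i : dz i = (\sum_l mdeg (v l) i)%N.
Proof. by rewrite /dz fct_sumE. Qed.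

Lemma monomial_deg_gt0 l : (0 < dz (v l))%N.
Proof. by rewrite monomial_degE (bigD1 l) //= mdeg1. Qed.

Section AtVariable.
Variables (l0 : 'I_m).
Let i := v l0.
Let fam := replace_gen i z.
Let dfam j := if j == i then dz else mdeg j.
Let S := no_linear i `&` @pos _ _ _ M 'I_n.

Lemma mdeg_inj (X : Type) : injective (@mdeg X).
Proof. by move=> x y /(congr1 (fun f => f y)); rewrite mdeg1 /mdeg; case: asboolP. Qed.

Lemma monomial_deg_neq j : dz <> mdeg j.
Proof. by move/(congr1 (@tdeg _)); rewrite monomial_tdeg /tdeg wdeg_mdeg; lia. Qed.

Lemma replaced_homog j : mhomog (dfam j) (fam j).
Proof.
by rewrite /dfam /fam /replace_gen; case: eqP => _; [exact: monomial_homog|exact: homog_gen].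
Qed.

Lemma replaced_deg_inj : injective dfam.
Proof.
move=> j j'; rewrite /dfam; case: eqP => [->|ji]; case: eqP => [->|ji'] //.
- by move=> e; case: (monomial_deg_neq e).
- by move=> e; case: (monomial_deg_neq (esym e)).
- exact: mdeg_inj.
Qed.

Lemma replaced_deg_neq0 j : dfam j <> 0.
Proof.
move/(congr1 (@tdeg _)); rewrite /dfam {2}/tdeg wdeg0.
by case: eqP => _; rewrite ?monomial_tdeg /tdeg ?wdeg_mdeg; lia.
Qed.

Lemma replaced_deg_neq j : dfam j <> mdeg i.
Proof.
rewrite /dfam; case: eqP => [_|ji]; first exact: monomial_deg_neq.
by move=> e; apply: ji; exact: mdeg_inj e.
Qed.

Lemma replaced_no_linear j : S (fam j).
Proof.
by split; apply: (hspan_homog _ (replaced_homog j)); [exact: replaced_deg_neq|exact: replaced_deg_neq0].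
Qed.

Lemma S_hspan a : S a -> hspan ([set e | e <> mdeg i] `&` [set e | e <> 0]) a.
Proof. by move=> [h1 h2]; exact: hspan_setI. Qed.

(** A product of elements of [S] has degree greater than 1. If it has degree exactly [m], all
    factors are linear and avoid [x_i]. The [x_j] violate the first condition, and [z], of degree
    [m] and involving [x_i], the second. *)
Lemma replaced_indep (a : 'I_n -> k) :
  decomp S (\sum_j a j *: fam j) -> forall j, a j = 0.
Proof.
move=> h; apply: (@distinct_degrees _ dfam fam
    [set e | 1 < tdeg e /\ (tdeg e = m -> e i = 0)]%N).
- exact: replaced_deg_inj.
- exact: replaced_homog.
- by move=> j; rewrite /fam /replace_gen; case: ifP => _; [exact: z_neq0|exact: gen_neq0].
- move=> j [/= t1 t2]; move: t1 t2; rewrite /dfam; case: ifP => _.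
    by rewrite monomial_tdeg => _ /(_ erefl) di; have := monomial_deg_gt0 l0; rewrite -/i di.
  by rewrite /tdeg wdeg_mdeg.
elim: h => [|c x y _ hx _ hy|w hw]; first exact: hspan0.
  by apply: hspanD hy; exact: hspanZ.
apply: hspan_mop (fun l => S_hspan (hw l)) => d hd /=.
have tge l : (1 <= tdeg (d l))%N by apply: tdeg_gt0; case: (hd l).
have s1 : (\sum_(l < m) 1 = m)%N by rewrite sum1_card card_ord.
rewrite /tdeg wdeg_sum; split.
  by rewrite (leq_trans m_ge2) // -[X in (X <= _)%N]s1; apply: leq_sum => l _; exact: tge.
move=> sm; rewrite fct_sumE big1 // => l _.
apply: contrapT => dl; case: (hd l) => /= dl1 _; apply: dl1; apply: tdeg_mdeg dl.
apply/eqP; rewrite eqn_leq tge andbT.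
have : (\sum_(l' | l' != l) 1 <= \sum_(l' | l' != l) tdeg (d l'))%N.
  by apply: leq_sum => l' _; exact: tge.
rewrite (bigD1 l) //= in sm; rewrite (bigD1 l) //= in s1.
move: sm s1; rewrite /tdeg; set t := wdeg _ _.
set b := bigop _ _ _; set c := bigop _ _ _; lia.
Qed.

Lemma NS_free_indep (I : finType) (b : I -> A) : (forall j, S (b j)) ->
  (forall a : I -> k, decomp S (\sum_j a j *: b j) -> forall j, a j = 0) ->
  injective (free_lift b : free_alg M I -> A).
Proof.
move=> Sb; apply: (free_indep m_ge2 (NS (no_linear_subalgebra i))) => j; by case: (Sb j).
Qed.

Lemma replaced_free : injective (free_lift fam : A -> A).
Proof. by apply: NS_free_indep; [exact: replaced_no_linear|exact: replaced_indep]. Qed.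

(** This is the image of [z] under the injective endomorphism [x_j |-> fam j]. Both final
    contradictions are with this fact. *)
Lemma replaced_monomial_neq0 : mop (fun l => fam (v l)) != 0.
Proof.
apply: contra_neq z_neq0 => f0; apply: replaced_free.
have [l o _] := lift_hom fam; rewrite (lin0 l) /z o -[RHS]f0; congr mop.
by apply/funext => j /=; rewrite lift_gen.
Qed.

Hypothesis stuck : forall (b : A) (db : nat), hspan [set e | tdeg e = db] b ->
  ~ injective (free_lift (oapp fam b) : free_alg M (option 'I_n) -> A).

Lemma sum_option (V : nmodType) (I : finType) (F : option I -> V) :
  \sum_o F o = F None + \sum_j F (Some j).
Proof.
rewrite (bigD1 None) //=; congr (_ + _).
by rewrite (reindex_omap Some id) => [|[]//]; apply: eq_bigl => j; rewrite eqxx.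
Qed.

(** As [b] is not free together with the family, it occurs in a linear relation modulo
    decomposables; its coefficient is nonzero by [replaced_indep], so one can solve for [b]. *)
Lemma stuck_decomp b db : S b -> hspan [set e | tdeg e = db] b ->
  exists a : 'I_n -> k, decomp S (b - \sum_j a j *: fam j).
Proof.
move=> Sb hb; apply: contrapT => no; apply: (stuck hb); apply: NS_free_indep.
  by move=> [j|] //=; exact: replaced_no_linear.
move=> a; rewrite sum_option /= => ha.
have aN : a None = 0.
  apply/eqP; apply: contrapT => /negP aN; apply: no.
  exists (fun j => - ((a None)^-1 * a (Some j))).
  have := decompZ (a None)^-1 ha; rewrite scalerDr scalerA mulVf // scale1r scaler_sumr.
  congr decomp; congr (_ + _); rewrite -sumrN; apply: eq_bigr => j _.
  by rewrite scalerA scaleNr opprK.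
by move: ha; rewrite aN scale0r add0r => /replaced_indep a0 [j|].
Qed.

Variable P : set ('I_n -> nat).
Hypotheses (P0 : P 0) (PD : forall d e, P d -> P e -> P (d + e)).
Hypotheses (Pgen : forall j, j != i -> P (mdeg j)) (Pz : P dz).

(* Every element without linear [x_i]-term is a polynomial in [z] and the [x_j], [j <> i]. *)
Lemma stuck_degree d (b : A) : mhomog d b -> d <> mdeg i -> ~ P d -> b = 0.
Proof.
move: {2}(tdeg d).+1 (ltnSn (tdeg d)) => N; elim: N d b => // N IH d b dN hb di nPd.
have d0 : d <> 0 by move=> d0; apply: nPd; rewrite d0.
have Sb : S b by split; exact: (hspan_homog _ hb).
have [a ha] := stuck_decomp Sb (hspan_homog (erefl (tdeg d)) hb).
apply: (mhomog_neq (P := [set e | P e \/ tdeg d < tdeg e]%N) hb); last by case; rewrite ?ltnn.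
rewrite -(subrK (\sum_j a j *: fam j) b); apply: hspanD; last first.
  apply: hspan_sum => j _; apply/hspanZ/(hspan_homog _ (replaced_homog j)); left.
  by rewrite /dfam; case: eqP => [//|/eqP]; exact: Pgen.
(* By induction, components of degree outside [P] and of total degree below that of [d] vanish. So a
   product of such factors has degree in [P], or it exceeds [tdeg d] because a second factor adds
   positive degree. *)
have hS x : S x -> hspan [set e | e <> 0 /\ (P e \/ (tdeg d <= tdeg e)%N)] x.
  move=> /S_hspan; apply: (hspan_lin (L := id)) => //; [exact: hspan0|exact: hspanD|].
  move=> e c [ei e0] hc; case: (pselect (P e \/ tdeg d <= tdeg e)%N) => he.
    exact: (hspan_homog _ hc).
  rewrite (IH e c) //; first exact: hspan0.
    by apply: (@leq_trans (tdeg d)) => //; rewrite ltnNge; apply/negP => ?; apply: he; right.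
  by move=> Pe; apply: he; left.
elim: ha => [|c x y _ hx _ hy|w hw]; first exact: hspan0.
  by apply: hspanD hy; exact: hspanZ.
apply: hspan_mop (fun l => hS _ (hw l)) => e he /=.
case: (pselect (forall l, P (e l))) => Pe.
  by left; elim/big_ind: _ => // l _; exact: Pe.
right; have [l nPl] : exists l, ~ P (e l) by exact/existsNP.
have [el0 [//|el]] := he l.
have [l' l'l] : exists l', l' != l.
  case: l {Pe nPl el0 el} => l lm; have lm' : (1 - l < m)%N by lia.
  by exists (Ordinal lm'); rewrite -val_eqE /=; lia.
rewrite [X in (_ < X)%N]wdeg_sum (bigD1 l) //= (bigD1 l') //=.
have [/tdeg_gt0 + _] := he l'; move: el; rewrite /tdeg.
set s := wdeg _ (e l); set t := wdeg _ (e l'); set r := bigop _ _ _; lia.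
Qed.
End AtVariable.
End GeneratorReplacement.

(** * Existence of a further free element *)

Section Unfaithful.
Variables (k : fieldType) (m : nat) (u : bool) (M : variety k m u) (n : nat).
Hypotheses (m_ge2 : (2 <= m)%N) (NS : Nielsen_Schreier M).
Local Notation A := (free_alg M 'I_n).

(* By [act_eq0], this holds for every homogeneous [z] of degree at least [2] if [A^e]
   does not act faithfully on [A]. *)
Definition not_extendable (i : 'I_n) (z : A) : Prop :=
  forall (b : A) (db : nat), hspan [set e | tdeg e = db] b ->
  ~ injective (free_lift (oapp (replace_gen i z) b) : free_alg M (option 'I_n) -> A).

Lemma sum_degE (I : finType) (d : I -> ('I_n -> nat)) j :
  (\sum_l d l) j = (\sum_l d l j)%N.
Proof. by rewrite fct_sumE. Qed.

Lemma mdegE (x y : 'I_n) : mdeg x y = (x == y).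
Proof. by rewrite /mdeg; congr nat_of_bool; apply/asboolP/eqP. Qed.

(** Let [p], [q] be the degrees of [z] in the two variables. Were [z] stuck at the second, all
    elements without linear term in it would satisfy [p * e i2 <= q * e i1]. Substituting [z] for
    the first variable in [z] gives a nonzero element of degrees [p * p] and [p * q + q], a
    violation. *)
Lemma two_variables_extendable (v : 'I_m -> 'I_n) (l1 l2 : 'I_m) :
  mop (fun l => gen M (v l)) != 0 -> v l1 != v l2 ->
  ~ not_extendable (v l2) (mop (fun l => gen M (v l))).
Proof.
set z := mop _ => z0 v12 stuck; set i1 := v l1 in v12 *; set i2 := v l2 in v12 stuck *.
pose dz := \sum_l mdeg (v l).
pose p := dz i1; pose q := dz i2.
have pE : p = (\sum_l (v l == i1))%N.
  by rewrite /p /dz sum_degE; apply: eq_bigr => l _; exact: mdegE.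
have qE : q = (\sum_l (v l == i2))%N.
  by rewrite /q /dz sum_degE; apply: eq_bigr => l _; exact: mdegE.
have p_gt0 : (0 < p)%N by exact: monomial_deg_gt0.
have q_gt0 : (0 < q)%N by exact: monomial_deg_gt0.
have /eqP := replaced_monomial_neq0 m_ge2 NS z0 l1; apply; rewrite -/i1 -/z.
pose d := \sum_l (if v l == i1 then dz else mdeg (v l)).
have d1 : d i1 = (p * p)%N.
  rewrite /d sum_degE {1}pE big_distrl; apply: eq_bigr => l _ /=.
  by case: ifP; rewrite ?mul1n // mdegE => ->.
have d2 : d i2 = (p * q + q)%N.
  rewrite /d sum_degE {1}pE [X in (_ + X)%N]qE big_distrl -big_split.
  apply: eq_bigr => l _ /=; case: eqP => [->|_]; last by rewrite mdegE.
  by rewrite (negbTE v12) addn0 mul1n.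
have hd : mhomog d (mop (fun l => replace_gen i1 z (v l))).
  apply: homog_op => l; rewrite /replace_gen.
  by case: ifP => _; [exact: monomial_homog|exact: homog_gen].
apply: (stuck_degree m_ge2 NS z0 (l0 := l2) stuck
  (P := [set e : 'I_n -> nat | p * e i2 <= q * e i1]%N) _ _ _ _ hd) => /=.
- by rewrite !muln0.
- by move=> e e' /= h h'; rewrite !fctE !mulnDr; exact: leq_add.
- by move=> j ji; rewrite mdegE (negbTE ji) muln0.
- by rewrite -/dz -/p -/q mulnC.
- by move/(congr1 (fun f => f i2)); rewrite d2 mdeg1; nia.
- by rewrite d1 d2; nia.
Qed.

Section OneVariable.
Variable i : 'I_n.
Let x : A := gen M i.
Let z : A := mop (fun=> x).
Hypotheses (z0 : z != 0) (stuck : not_extendable i z).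

Let l0 : 'I_m := Ordinal (ltnW m_ge2).
Let dz : 'I_n -> nat := \sum_(l < m) mdeg i.
Let P : set ('I_n -> nat) := [set e | m %| e i]%N.

Let dzi : dz i = m.
Proof.
by rewrite /dz sum_degE; under eq_bigr do rewrite mdeg1; rewrite sum1_card card_ord.
Qed.

Let z_homog : mhomog dz z.
Proof. exact: (monomial_homog M (fun=> i)). Qed.

Let z_deg : hspan [set e | e i = m] z.
Proof. exact: (hspan_homog _ z_homog). Qed.

Let x_deg : hspan [set e | e i = 1%N] x.
Proof. by apply: (hspan_homog _ (homog_gen _ _ i)); rewrite /= mdeg1. Qed.

(** Both [z] and the [x_j], [j != i], have [x_i]-degree divisible by [m], so [stuck_degree] applies
    to this condition. *)
Let dvd0 (a : A) : hspan [set e | ~ P e] a -> hspan [set e | 1 < tdeg e]%N a -> a = 0.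
Proof.
move=> h1 h2; have := hspan_setI h1 h2.
apply: (hspan_lin (L := id) (S := [set 0])) => //.
  by move=> b c -> ->; rewrite addr0.
move=> d c [nP td] hc; apply: (stuck_degree m_ge2 NS (v := fun=> i) (l0 := l0) z0 stuck
  (P := P) _ _ _ _ hc) => //=.
- exact: dvdn0.
- by move=> e e'; exact: dvdn_add.
- by move=> j ji; rewrite /P /= mdegE (negbTE ji) dvdn0.
- by rewrite /P /= -/dz dzi.
- by move=> di; move: td; rewrite /= di /tdeg wdeg_mdeg.
Qed.

Let dvdP (a : A) : hspan [set e | 1 < tdeg e]%N a -> hspan P a.
Proof.
apply: (hspan_lin (L := id)) => //; [exact: hspan0|exact: hspanD|] => d c td hc.
case: (pselect (P d)) => Pd; first exact: (hspan_homog _ hc).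
by rewrite (dvd0 (hspan_homog _ hc) (hspan_homog _ hc)) //; exact: hspan0.
Qed.

Let mop_tdeg (w : 'I_m -> A) : (forall l, hspan [set e | 0 < e i]%N (w l)) ->
  hspan [set e | 1 < tdeg e]%N (mop w).
Proof.
move=> hw; apply: (decomp_tdeg m_ge2 (S := @pos _ _ _ M 'I_n)) => //.
apply: decomp_mop => l; apply: hspan_sub (hw l) => e /= + e0.
by rewrite e0.
Qed.

Lemma one_variable_extendable : False.
Proof.
have m_gt0 : (0 < m)%N by exact: ltnW.
pose phi : A -> A := free_lift (replace_gen i (x + z)).
have [phil phio _] : is_hom phi by exact: lift_hom.
have phix : phi x = x + z by rewrite /phi lift_gen /replace_gen eqxx.
have xzd : hspan [set e | e i = 1%N \/ e i = m] (x + z).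
  by apply: hspanD; [apply: hspan_sub x_deg|apply: hspan_sub z_deg] => e /=; [left|right].
have weak (a : A) : hspan [set e | e i = 1%N \/ e i = m] a -> hspan [set e | 0 < e i]%N a.
  by apply: hspan_sub => e /= [->|->].
have zd : hspan [set e | e i = 1%N \/ e i = m] z.
  by apply: hspan_sub z_deg => e /=; right.
have xd : hspan [set e | e i = 1%N \/ e i = m] x.
  by apply: hspan_sub x_deg => e /=; left.
have phiz : phi z = mop (fun=> x + z) by rewrite /z phio; congr mop; apply/funext => l /=.
have phizP : hspan P (phi z) by rewrite phiz; apply/dvdP/mop_tdeg => l; exact: weak.
have phizpos : hspan [set e | 0 < e i]%N (phi z).
  rewrite phiz; apply: (@hspan_mop _ _ _ _ _ (fun=> [set e | 0 < e i]%N)) => [e he|l].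
    by rewrite /= sum_degE (bigD1 l0) //= addn_gt0 (he l0).
  exact: weak.
(* The [x_i]-degree is [m + (m - 1)], not divisible by [m]. *)
have e1 : mop (put (fun=> x) l0 z) = 0.
  apply: dvd0.
    apply: (@hspan_mop _ _ _ _ _
      (fun l => if l == l0 then [set e | e i = m] else [set e | e i = 1%N])) => [e he|l].
      rewrite /P /= sum_degE (bigD1 l0) //=.
      have -> : e l0 i = m by have := he l0; rewrite ?eqxx.
      rewrite (eq_bigr (fun=> 1%N)) => [|l ll0]; last by have := he l; rewrite (negbTE ll0).
      rewrite sum1_card cardC1 card_ord dvdn_addr // => /dvdn_leq; lia.
    by rewrite /put; case: eqP => _.
  by apply: mop_tdeg => l; rewrite /put; case: eqP => _; exact: weak.
have e2 : mop (put (fun=> x + z) l0 (phi z)) = 0.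
  have := congr1 phi e1; rewrite (lin0 phil) phio => <-; congr mop.
  by apply/funext => l; rewrite /= /put; case: eqP.
(* The difference from [e2] telescopes into products with [phi z] in slot [l0] and [x] in some other
   slot. Modulo [m] their [x_i]-degree counts the slots filled with [x]: between 1 and [m - 1], so
   [dvd0] kills them. *)
have e3 : mop (put (fun=> z) l0 (phi z)) = 0.
  apply/eqP; rewrite -oppr_eq0 -[- _]add0r -{1}e2; apply/eqP/dvd0.
    apply: mop_congr; [exact: hspan0|exact: hspanD|] => w j hw.
    have [->|jl0] := eqVneq j l0.
      rewrite !put_eq subrr (@mop0 _ _ _ _ _ l0) ?put_eq //; exact: hspan0.
    rewrite !(put_neq _ _ jl0) addrK.
    apply: (@hspan_mop _ _ _ _ _ (fun l => if l == l0 then P else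
      if l == j then [set e | e i = 1%N] else [set e | e i = 1%N \/ e i = m]))
      => [e he|l].
      rewrite /P /= sum_degE /dvdn -modn_summ.
      have rb l : (e l i %% m <= (l != l0))%N.
        have := he l; case: eqP => _ /=; first by rewrite /P /= /dvdn => /eqP ->.
        by case: eqP => _ /=; [move=> ->|case=> ->]; rewrite ?modnn // modn_small.
      have rj : (e j i %% m = 1)%N.
        by have := he j; rewrite (negbTE jl0) eqxx /= => ->; rewrite modn_small.
      have sb : (\sum_l e l i %% m < m)%N.
        apply: (@leq_ltn_trans (\sum_l (l != l0))); first exact: leq_sum.
        rewrite -[X in (X < _)%N]/(\sum_l nat_of_bool (l != l0))%N.
        rewrite -big_mkcond /= sum1_card cardC1 card_ord; lia.
      rewrite modn_small //; apply/eqP.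
      by rewrite (bigD1 j) //= rj.
    have [->|ll0] := eqVneq l l0.
      by rewrite put_neq 1?eq_sym //; case: (hw l0) => ->; rewrite put_eq.
    have [->|lj] := eqVneq l j; first by rewrite put_eq; exact: x_deg.
    by rewrite put_neq //; case: (hw l) => ->; rewrite put_neq.
  by apply: hspanB; apply: mop_tdeg => l; rewrite /put; case: eqP => _ //; exact: weak.
have phizE : phi z = z + (phi z - z) by rewrite addrC subrK.
(* Each telescoped term has [z] in one slot, of degree [m], and a positive degree in another. *)
have gt_m : hspan [set e | m < e i]%N (phi z - z).
  rewrite phiz; apply: mop_congr; [exact: hspan0|exact: hspanD|] => w j hw.
  rewrite [x + z]addrC addrK.
  apply: (@hspan_mop _ _ _ _ _ (fun l => if l == j then [set e | e i = m]
    else [set e | 0 < e i]%N)) => [e he|l].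
    rewrite /= sum_degE (bigD1 j) //=; have := he j; rewrite ?eqxx /= => ->.
    rewrite -[X in (X < _)%N]addn0 ltn_add2l.
    have [l lj] : exists l : 'I_m, l != j.
      case: j {hw he} => j jm; have lm : (1 - j < m)%N by lia.
      by exists (Ordinal lm); rewrite -val_eqE /=; lia.
    by rewrite (bigD1 l) //= addn_gt0; have := he l; rewrite (negbTE lj) => ->.
  rewrite /put; case: eqP => // _; case: (hw l) => ->; exact: weak.
have := e3; rewrite phizE (linD (mop_multilinear _ l0)).
have -> : put (fun=> z) l0 z = fun=> z by exact: (put_id (fun=> z)).
(* By [zz], the product with [z] in all slots, of [x_i]-degree [m * m], equals an element of larger
   degrees and so vanishes. *)
move/eqP; rewrite addr_eq0 => /eqP zz.
have /eqP := replaced_monomial_neq0 m_ge2 NS (v := fun=> i) z0 l0; apply; rewrite /replace_gen eqxx -/x -/z.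
apply: (@hspan_disj _ _ _ _ _ [set e | e i = m * m]%N [set e | m * m < e i]%N).
- by move=> e /= ->; rewrite ltnn.
- apply: (@hspan_mop _ _ _ _ _ (fun=> [set e | e i = m])) => [e he|l //].
  rewrite /= sum_degE (eq_bigr (fun=> m)) => [|l _]; last exact: he.
  by rewrite sum_nat_const card_ord.
rewrite zz; apply/hspanN.
apply: (@hspan_mop _ _ _ _ _ (fun l => if l == l0 then [set e | m < e i]%N
  else [set e | e i = m])) => [e he|l]; last by rewrite /put; case: eqP.
rewrite /= sum_degE (bigD1 l0) //= (eq_bigr (fun=> m)) => [|l ll0].
  by have := he l0; rewrite ?eqxx (eq_bigl (mem (predC1 l0))) // sum_nat_const cardC1 card_ord /=; nia.
by have := he l; rewrite (negbTE ll0).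
Qed.
End OneVariable.
End Unfaithful.

(** * Faithful action, and the case where products of generators vanish *)

Section FaithfulOrLinear.
Variables (k : fieldType) (m : nat) (u : bool) (M : variety k m u) (n : nat).
Hypothesis m_ge2 : (2 <= m)%N.
Local Notation A := (free_alg M 'I_n).

Lemma Ae_act_faithful (v : 'I_m -> 'I_n) (w : Ae M n) : Nielsen_Schreier M ->
  mop (fun l => gen M (v l)) != 0 -> (forall a : A, Ae_act w a = 0) -> w = 0.
Proof.
move=> NS z0 w0; apply: Ae_code_eq0; apply: contrapT => t0.
(* An additional free element [b] would make the code of [w] vanish by [act_eq0]. *)
have stuck l : not_extendable (v l) (mop (fun l => gen M (v l))).
  move=> b db hb inj; apply: t0; apply: (act_eq0 _ w0 m_ge2 _ hb inj).
    exact: Ae_code_opalg.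
  by apply: (hspan_homog _ (monomial_homog M v)); exact: monomial_tdeg.
case: (pselect (exists l1 l2, v l1 != v l2)) => [[l1 [l2 v12]]|veq].
  exact: two_variables_extendable z0 v12 (stuck l2).
have vE : v = fun=> v (Ordinal (ltnW m_ge2)).
  apply/funext => l; apply/eqP; apply: contrapT => /negP vl.
  by apply: veq; exists l, (Ordinal (ltnW m_ge2)).
have := stuck (Ordinal (ltnW m_ge2)); move: z0; rewrite vE => z0 st.
exact: one_variable_extendable z0 st.
Qed.

Section Linear.
Hypothesis mop_gen0 : forall v : 'I_m -> 'I_n, mop (fun l => gen M (v l)) = 0.

(** Substituting 1 for [x_i] in the vanishing product of copies of [x_i] gives [1 = 0], whence
    [x_i = 1 x_i = 0]. *)
Lemma linear_not_unital (i : 'I_n) (h : u) : False.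
Proof.
pose l0 : 'I_m := Ordinal (ltnW m_ge2); pose l1 : 'I_m := Ordinal m_ge2.
have [l o _] := lift_hom (fun _ : 'I_n => mone h : A).
have one0 : mone h = 0 :> A.
  rewrite -[LHS](mop_one h l0) (_ : put _ _ _ = fun=> mone h); last first.
    by apply/funext => j; rewrite /put if_same.
  have := congr1 (free_lift (fun _ : 'I_n => mone h : A)) (mop_gen0 (fun=> i)).
  by rewrite (lin0 l) o => <-; congr mop; apply/funext => j /=; rewrite lift_gen.
have /eqP := gen_neq0 M i; apply; rewrite -(mop_one h l0 (gen M i)).
by apply: (mop0 (i := l1)); rewrite put_neq.
Qed.

Lemma linear_span (i : 'I_n) (a : A) : exists f : 'I_n -> k, a = \sum_j f j *: gen M j.
Proof.
pose S : set A := [set a | exists f : 'I_n -> k, a = \sum_j f j *: gen M j].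
have S0 : S 0 by exists (fun=> 0); rewrite big1 // => j _; rewrite scale0r.
have SD b c : S b -> S c -> S (b + c).
  move=> [f ->] [g ->]; exists (fun j => f j + g j).
  by rewrite -big_split; apply: eq_bigr => j _; rewrite scalerDl.
rewrite -/(S a) -(lift_id a) /free_lift; elim: (rep a) => /= [j|h||//|c t [f ->]|ts IH].
- exists (fun l => (l == j)%:R); rewrite (bigD1 j) //= eqxx scale1r big1 ?addr0 //.
  by move=> l /negbTE ->; rewrite scale0r.
- by case: (linear_not_unital i h).
- exact: S0.
- by move=> s Ss t St; exact: SD.
- exists (fun j => c * f j); rewrite scaler_sumr.
  by apply: eq_bigr => j _; rewrite scalerA.
apply: (@mop_span _ _ _ _ S (fun=> range (gen M (X := 'I_n))) (fun=> S)) => // [v gv|_ L Ll LS].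
  have /choice[x hx] l : exists j, gen M j = v l by have [j _ <-] := gv l; exists j.
  by rewrite (_ : v = fun l => gen M (x l)) ?mop_gen0 //; apply/funext.
move=> b [f ->]; rewrite (lin_sum Ll); elim/big_ind: _ => // j _.
rewrite (linZ Ll); have [g ->] : S (L (gen M j)) by apply: LS; exists j.
exists (fun l => f j * g l); rewrite scaler_sumr.
by apply: eq_bigr => l _; rewrite scalerA.
Qed.

Definition is_scalar (w : Ae M n) : Prop := exists c : k, forall o, w o = c *: o.

(** The values of [D] on generators are linear, so their Fox derivatives are the coefficients;
    scalars are closed under sums and products. *)
Lemma jacobian_scalar (D : LA M n) s i j : is_scalar ((jacobian D ^+ s) i j).
Proof.
have scalar0 : is_scalar 0 by exists 0 => o.
have scalarD w w' : is_scalar w -> is_scalar w' -> is_scalar (w + w').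
  by move=> [c hc] [c' hc']; exists (c + c') => o; rewrite /= hc hc' scalerDl.
have scalarM w w' : is_scalar w -> is_scalar w' -> is_scalar (w * w').
  by move=> [c hc] [c' hc']; exists (c * c') => o; rewrite /= hc hc' scalerA.
have scalar1 : is_scalar 1 by exists 1 => o; rewrite scale1r.
elim: s i j => [|s IH] i j.
  by rewrite expr0 -[1]/(1%:M) mxE; case: (i == j).
rewrite exprS -[jacobian D * _]/(jacobian D *m _) mxE.
elim/big_ind: _ => // l _; apply: scalarM => //; rewrite mxE.
set b := (D : der A) _; have [f fE] := linear_span i b.
exists (f l) => o.
have <- : (fun j => op_scale (f j) (op_one (@U_gens _ _ _ M n))) = fox b; last by [].
apply: fox_uniq; rewrite /is_fox fE.
have [il _ _] := @incl_hom k m u M n; have [dl _] := derP (OmegaD M n).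
rewrite (lin_sum il) (lin_sum dl); apply: eq_bigr => j' _.
by rewrite (linZ il) (linZ dl) /Defs.incl lift_gen der_of_gen.
Qed.

Lemma scalar_faithful (i : 'I_n) (w : Ae M n) : is_scalar w ->
  (forall a : A, Ae_act w a = 0) -> w = 0.
Proof.
move=> [c hc] /(_ (gen M i)); rewrite (Ae_actE i) hc.
have [l _ _] := subst_y_hom (fun _ : 'I_n => gen M i).
rewrite /= (linZ l) (subst_y_gen _ i) => /eqP.
rewrite scaler_eq0 (negbTE (gen_neq0 M i)) orbF => /eqP c0.
by apply: opalg_eqP => o; rewrite hc c0 /= scale0r.
Qed.
End Linear.
End FaithfulOrLinear.

Theorem lemma5 (k : fieldType) (m : nat) (m_ge2 : (2 <= m)%N) (u : bool)
    (M : variety k m u) (NS : Nielsen_Schreier M)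
    (n : nat) (D : LA M n) :
  nilpotent_elt (jacobian D) <-> nilpotent_elt (rmult D).
Proof.
split; first exact: jacobian_nilpotent_rmult.
apply: rmult_nilpotent_jacobian => s i j.
case: (pselect (exists v : 'I_m -> 'I_n, mop (fun l => gen M (v l)) != 0)).
  by move=> [v z0]; exact: Ae_act_faithful z0.
(* The row index [i] provides the generator on which a scalar is tested. *)
move=> no; apply: (scalar_faithful i); apply: jacobian_scalar => // v.
by apply/eqP; apply: contrapT => /negP z0; apply: no; exists v.
Qed.
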